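(* Let $A$ be a $2\times 2$ integer matrix with $|\det A|=1$ and with an eigenvalue $\lambda$ satisfying $|\lambda|>1$. Let $T:\mathbb{T}^2\to\mathbb{T}^2$ be $T(x)=Ax \pmod 1$, let $\alpha>0$, and let $r_n=e^{-\alpha n}$ for $n\ge 1$. Put \[ E=\{\,x\in\mathbb{T}^2 : T^n(x)\in B(x,r_n)\ \text{for infinitely many } n\ge 1\,\} \] and \[ s_0=\min\Bigl\{\frac{2\log|\lambda|}{\alpha+\log|\lambda|},\ \frac{\log|\lambda|}{\alpha}\Bigr\}. \] Then $\dim_{\mathrm H}E=s_0$. Moreover, $E\in\mathcal{G}^{s_0}(\mathbb{T}^2)$.
   Context: $\mathbb{T}^2=\mathbb{R}^2/\mathbb{Z}^2$ with its usual quotient (Euclidean) distance $d$; $B(x,r)=\{y: d(x,y)<r\}$; $\dim_{\mathrm H}$ denotes Hausdorff dimension. Falconer's large intersection class: for $s\in(0,m]$, $\mathcal{G}^s(\mathbb{R}^m)$ is the largest class of $G_\delta$ subsets of $\mathbb{R}^m$ such that every set in the class has Hausdorff dimension at least $s$ and the class is closed under similarity transformations and countable intersections. Equivalently, a $G_\delta$ set $F\subset\mathbb{R}^m$ belongs to $\mathcal{G}^s(\mathbb{R}^m)$ iff $\dim_{\mathrm H}\bigcap_{i\ge1}f_i(F)\ge s$ for every sequence $(f_i)_{i\ge 1}$ of similarity transformations of $\mathbb{R}^m$. The class $\mathcal{G}^s(\mathbb{T}^m)$ is the corresponding class on the torus: $F\subset\mathbb{T}^m$ belongs to $\mathcal{G}^s(\mathbb{T}^m)$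 iff its $\mathbb{Z}^m$-periodic lift to $\mathbb{R}^m$ belongs to $\mathcal{G}^s(\mathbb{R}^m)$. *)

(* Defs.v *)
From HB Require Import structures.
From mathcomp Require Import all_boot all_order all_algebra.
From mathcomp Require Import all_classical all_reals all_analysis.
From mathcomp Require Import borel_hierarchy complex.

Set Implicit Arguments.
Unset Strict Implicit.
Unset Printing Implicit Defensive.

Import Order.TTheory GRing.Theory Num.Theory.
Import numFieldNormedType.Exports.

Local Open Scope classical_set_scope.
Local Open Scope ring_scope.
Local Open Scope quotient_scope.

Section Hausdorff.
Context {R : realType} {X : Type}.
Variable d : X -> X -> R.

(* The diameter of the empty set is -oo here; hausdorff_gauge never uses it. *)
Definition diameter (U : set X) : \bar R :=
  ereal_sup [set (d x y)%:E | x in U & y in U].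

(* diam(U)^s, with the empty set counted as 0 for every s, including s = 0. *)
Definition hausdorff_gauge (s : R) (U : set X) : \bar R :=
  (if U == set0 then 0 else poweR (diameter U) s)%E.

Definition hausdorff_content (s delta : R) (E : set X) : \bar R :=
  ereal_inf [set (\sum_(0 <= i <oo) hausdorff_gauge s (U i))%E |
    U in [set U : nat -> set X | E `<=` \bigcup_i U i /\
                                 forall i, (diameter (U i) <= delta%:E)%E]].

Definition hausdorff_measure (s : R) (E : set X) : \bar R :=
  ereal_sup [set hausdorff_content s delta E | delta in [set delta | 0 < delta]].

Definition hausdorff_dim (E : set X) : \bar R :=
  ereal_inf [set s%:E | s in [set s | 0 <= s /\ hausdorff_measure s E = 0%E]].

End Hausdorff.

Section LargeIntersection.
Context {R : realType} {m : nat}.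

(* The library norm on matrices is the max norm, hence this definition. *)
Definition edist (u v : 'cV[R]_m) : R :=
  Num.sqrt (\sum_(i < m) (u i 0 - v i 0) ^+ 2).

Definition similarity (f : 'cV[R]_m -> 'cV[R]_m) : Prop :=
  exists2 c : R, 0 < c & forall u v, edist (f u) (f v) = c * edist u v.

(* Falconer's class G^s(R^m), for 0 < s <= m. *)
Definition large_intersection (s : R) : set (set 'cV[R]_m) :=
  [set F | Gdelta F /\
    forall f : nat -> 'cV[R]_m -> 'cV[R]_m, (forall i, similarity (f i)) ->
      (s%:E <= hausdorff_dim edist (\bigcap_i (f i @` F)))%E].

End LargeIntersection.

Section Torus.
Context (R : realType) (m : nat).

Definition int_lattice (v : 'cV[R]_m) : bool := v \is a mxOver Num.int.

Lemma int_lattice_closed : zmod_closed int_lattice.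
Proof.
split=> [|u v /mxOverP uZ /mxOverP vZ]; apply/mxOverP => i j; rewrite !mxE.
  exact: rpred0.
exact: rpredB.
Qed.

HB.instance Definition _ :=
  GRing.isZmodClosed.Build 'cV[R]_m int_lattice int_lattice_closed.

Definition torus := Quotient.quot (GRing.ZmodClosed.clone _ int_lattice _).

Lemma pi_torusP (u v : 'cV[R]_m) :
  reflect (\pi_torus u = \pi_torus v) (u - v \is a mxOver Num.int).
Proof.
by apply: (iffP idP) => [h|/eqP]; [apply/eqP|]; rewrite -Quotient.idealrBE.
Qed.

Definition torus_dist (x y : torus) : R :=
  inf [set edist u v | u in [set u | \pi_torus u = x]
                     & v in [set v | \pi_torus v = y]].

Definition torus_ball (x : torus) (r : R) : set torus :=
  [set y | torus_dist x y < r].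

Definition torus_map (A : 'M[int]_m) (x : torus) : torus :=
  \pi_torus (map_mx intr A *m repr x).

Lemma torus_mapE (A : 'M[int]_m) (u : 'cV[R]_m) :
  torus_map A (\pi_torus u) = \pi_torus (map_mx intr A *m u).
Proof.
apply/pi_torusP; rewrite -mulmxBr; apply: mxOverM.
  by apply/mxOverP => i j; rewrite mxE; exact: intr_int.
by apply/pi_torusP; rewrite reprK.
Qed.

Definition torus_large_intersection (s : R) : set (set torus) :=
  [set F | large_intersection s (\pi_torus @^-1` F)].

Definition recurrent_set (T : torus -> torus) (r : nat -> R) : set torus :=
  [set x | infinite_set [set n | (1 <= n)%N /\
                                 torus_ball x (r n) (iter n T x)]].

End Torus.

Arguments torus_dist {R m}.

(* Main.v *)
Require Import Defs.
From mathcomp Require Import all_boot all_order all_algebra.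
From mathcomp Require Import all_classical all_reals all_analysis.
From mathcomp Require Import borel_hierarchy complex.
From mathcomp Require Import zify ring lra.
Import Defs.

Set Implicit Arguments.
Unset Strict Implicit.
Unset Printing Implicit Defensive.

Import Order.TTheory GRing.Theory Num.Theory.
Import numFieldNormedType.Exports.
Local Open Scope ring_scope.

(* Lift to the plane and use the eigen-coordinates [xi], [eta] of [A].  On integer
   vectors [xi * eta] is a nonzero multiple of the norm form of the quadratic field
   of [lambda], so it takes nonzero integer values; hence a box of area [V] in these
   coordinates contains [O(1 + V)] integer points, whatever its shape.
   The points returning at time [n] form ellipses of semi-axes about
   [r_n |lambda|^-n] and [r_n] around the solutions of [A^n x - x] integer, about
   [|lambda|^n] of them modulo [Z^2].  Covering each by one set, or by [|lambda|^n]
   balls, gives the two upper bounds.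
   Lower bound: for [n = 2 m] with [m] even, the periodic points form the fixed
   lattice [sigma Z^2], where [sigma] changes the sign of [eta], scaled by
   [1 / (|lambda|^m - |lambda|^-m)]; so every ball contains its share of ellipses,
   and box counting shows that they spread enough ("ubiquity") to
   carry, for any [s < s0], a Cantor set on which the uniform counting measures
   satisfy a Frostman bound of exponent [s].  Ubiquity is invariant under
   similarities, and the Cantor construction treats countably many ubiquitous
   families at once, which is the large intersection property. *)

(** * Ubiquitous families and Cantor sets *)

(** A ball of radius [rho] between [a] and [b] meets the ellipses whose centres lie in a box of
    sides about [rho] and [b]. In a general lattice such a thin box can hold far more points than
    its area predicts, a whole row along its long side; here that side is an eigendirection, and
    [frame_int] forbids such rows. No other equidistribution is used. Taking [n] a multiple of 4
    makes the eigenvalues of [A^(n/2)] the positive numbers [lam] and [lam^-1], whatever the signs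
    of [l] and of the determinant. Then [A^n - 1 = A^(n/2) (A^(n/2) - A^(-n/2))], and the second
    factor is [q] times the reflection [sigma]. The two terms of [s0] are the critical exponents at
    the two scales of an ellipse: [q^2] ellipses per unit area require [q^2 * b^s] to be large, and
    their [q^2 * b / a] balls require [(q^2 * b / a) * a^s] to be large. No limit measure is formed:
    compactness reduces a cover to a finite one, which is tested against the counting measure of one
    late generation. *)

Section Cantor.
Local Open Scope classical_set_scope.
Context {R : realType} {X : normedModType R}.
Implicit Types (V : nat -> set X) (ps : seq X) (s a K eps C rho : R) (x y p : X).

(* In every ball of radius [a0] one finds [M] small balls contained in [V n] and,
   down to their radius [a], spread like the plane measure, up to an error
   [theta * rho^s] that can be made arbitrarily small; [C] does not depend on [a0]. *)
Definition ubiquitous_with C s V := forall (a0 theta : R) (n0 : nat),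
  0 < a0 -> 0 < theta -> exists n a M,
  [/\ (n0 <= n)%N, 0 < a, a <= theta, (0 < M)%N & forall p, exists cs : seq X,
    [/\ size cs = M,
      forall c, c \in cs ->
        `|c - p| + a <= a0 /\ forall y, `|y - c| <= a -> V n y &
      forall x rho, a <= rho ->
        (count (fun c => `|c - x| <= 2 * rho) cs)%:R <=
          M%:R * (C * (rho / a0) ^+ 2 + theta * rho `^ s)]].

Definition ubiquitous s V := exists2 C, 0 < C & ubiquitous_with C s V.

(* [K] is the constant of a Frostman bound for the uniform measure on the balls of
   radius [a] around [ps], at scales at least [a]; the gain [eps] at scale [a] pays
   for the constant of [ubiquitous_with] at the next generation. *)
Definition spread s K eps ps a := [/\ 0 < a, (0 < size ps)%N,
  forall x rho, a <= rho ->
    (count (fun p => `|p - x| <= rho + a) ps)%:R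
      <= K * (size ps)%:R * rho `^ s &
  forall x, (count (fun p => `|p - x| <= 2 * a) ps)%:R
    <= K * eps * (size ps)%:R * a `^ s].

Lemma count_flatten_le (T : eqType) (P Q : pred T) (f : T -> seq T) (B : R) (ps' : seq T) :
  0 <= B -> (forall z, (count P (f z))%:R <= B) ->
  (forall z w, w \in f z -> P w -> Q z) ->
  (count P (flatten (map f ps')))%:R <= (count Q ps')%:R * B.
Proof.
move=> B0 PB PQ; elim: ps' => [|p ps' IH] /=; first by rewrite mul0r.
rewrite count_cat !natrD mulrDl; apply: lerD => //.
have [Qp|nQp] := boolP (Q p); first by rewrite mul1r.
rewrite mul0r (_ : count P (f p) = 0%N)//; apply/eqP.
rewrite -leqn0 leqNgt -has_count; apply: contra nQp => /hasP[c cf Pc].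
exact: PQ cf Pc.
Qed.

(** Subdividing naively would multiply [K] by [C] at every generation. The gain [eps] stored at
    scale [a] absorbs this factor, and the next gain [eps'] is bought by making [a'] tiny. *)
Lemma spread_step s K eps eps' C V ps a (n0 : nat) (eta : R) :
  0 < s < 2 -> 1 <= K -> 0 < eps' -> 0 < C -> eps * C <= 2^-1 -> 0 < eta ->
  spread s K eps ps a -> ubiquitous_with C s V ->
  exists ps' a' n, [/\ spread s K eps' ps' a', (n0 <= n)%N, a' <= eta &
    forall c, c \in ps' ->
      (exists2 p, p \in ps & `|c - p| + a' <= a) /\
      forall y, `|y - c| <= a' -> V n y].
Proof.
move=> /andP[s0 s2] K1 e0 C0 eC eta0 [a_gt0 N0 large small] ubi.
pose D := C / a ^+ 2.
have D0 : 0 < D by rewrite divr_gt0// exprn_gt0.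
(* At scale [a'] the main term is [D * a'^2]; since [s < 2], [a' <= t] makes it at most
   [eps' / 2 * a'^s]. *)
pose t := (eps' / (2 * D)) `^ (2 - s)^-1.
have t0 : 0 < t by rewrite powR_gt0// divr_gt0// mulr_gt0.
(* [eta] and [t] bound the new radius; [2^-1] and [eps' / 2] bound the error term, between [a'] and
   [a] and at [a'] itself. *)
pose theta := Num.min (Num.min eta a) (Num.min (Num.min t (eps' / 2)) 2^-1).
have theta0 : 0 < theta by rewrite !lt_min eta0 a_gt0 t0 divr_gt0// invr_gt0 /=.
have [n [a' [M [n0n a'0 a'theta M0 chP]]]] := ubi a theta n0 a_gt0 theta0.
have /choice[f fP] := chP.
move: a'theta; rewrite !le_min => /andP[/andP[a'eta a'a] /andP[/andP[a't _] _]].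
have th_e : theta <= eps' / 2 by rewrite !ge_min lexx !orbT.
have th_2 : theta <= 2^-1 by rewrite !ge_min lexx !orbT.
have szE : size (flatten (map f ps)) = (size ps * M)%N.
  elim: (ps) => //= p ps' IH; rewrite size_cat IH mulSn.
  by have [-> _ _] := fP p.
have Mr : 0 < M%:R :> R by rewrite ltr0n.
have Nr : 0 < (size ps)%:R :> R by rewrite ltr0n.
have pow2 rho : 0 < rho -> (rho / a) ^+ 2 = rho `^ s * rho `^ (2 - s) / a ^+ 2.
  move=> r0; rewrite -powRD ?(gt_eqF r0) ?implybT//.
  by rewrite addrC subrK expr_div_n powR_mulrn ?ltW.
have bound_ge0 rho : 0 <= M%:R * (C * (rho / a) ^+ 2 + theta * rho `^ s).
  rewrite mulr_ge0// addr_ge0// ?(mulr_ge0 (ltW C0) (sqr_ge0 _))//.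
  by rewrite mulr_ge0 ?powR_ge0 ?(ltW theta0).
exists (flatten (map f ps)), a', n; split => //; last first.
  move=> c /flatten_mapP[p pps cf]; have [_ /(_ c cf)[c1 c2] _] := fP p.
  by split => //; exists p.
have near_parent x rho : forall p c, c \in f p -> `|c - x| <= rho + a' ->
    `|p - x| <= rho + a.
  move=> p c cf cx; have [_ /(_ c cf)[c1 _] _] := fP p.
  have := ler_distD c p x; rewrite (distrC p c); lra.
split => //.
- by rewrite szE muln_gt0 N0.
- move=> x rho a'rho; rewrite szE natrM.
  have rho0 : 0 < rho by apply: lt_le_trans a'rho.
  have [arho|rhoa] := leP a rho.
    apply: le_trans (_ : (count (fun p => `|p - x| <= rho + a) ps)%:R * M%:R <= _).
      apply: count_flatten_le => //; last exact: near_parent.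
      by move=> p; have [<- _ _] := fP p; rewrite ler_nat count_size.
    rewrite mulrA [leRHS]mulrAC ler_wpM2r//.
    exact: large.
  have cnt p : (count (fun c => `|c - x| <= rho + a') (f p))%:R <=
      M%:R * (C * (rho / a) ^+ 2 + theta * rho `^ s).
    have [_ _ /(_ x rho a'rho) h] := fP p; apply: le_trans h.
    rewrite ler_nat; apply: sub_count => c /= h; lra.
  have B0 := bound_ge0 rho.
  apply: le_trans (count_flatten_le ps B0 cnt (near_parent x rho)) _.
  rewrite mulrCA [leRHS](_ : _ = M%:R * (K * (size ps)%:R * rho `^ s)); last by ring.
  rewrite ler_wpM2l// mulrDr.
  (* One half pays for the main term, summed over the parents near [x] only; the other half for the
     error term, summed over all parents. *)
  rewrite [leRHS](_ : _ = K * (size ps)%:R * rho `^ s / 2 +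
    K * (size ps)%:R * rho `^ s / 2); last by field.
  apply: lerD.
    apply: (@le_trans _ _ ((K * eps * (size ps)%:R * a `^ s) * (C * (rho / a) ^+ 2))).
      rewrite ler_wpM2r ?(mulr_ge0 (ltW C0) (sqr_ge0 _))//.
      apply: le_trans (small x); rewrite ler_nat; apply: sub_count => p /= h.
      by apply: le_trans h _; lra.
    rewrite pow2//.
    have as_ : a `^ s * rho `^ (2 - s) <= a ^+ 2.
      apply: (@le_trans _ _ (a `^ s * a `^ (2 - s))).
        by rewrite ler_wpM2l ?powR_ge0// ge0_ler_powR ?nnegrE ?ltW// subr_gt0.
      by rewrite -powRD ?(gt_eqF a_gt0) ?implybT// addrC subrK powR_mulrn// ltW.
    rewrite [leLHS](_ : _ = (K * (size ps)%:R * rho `^ s) * (eps * C) *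
      ((a `^ s * rho `^ (2 - s)) / a ^+ 2)); last by ring.
    have K0 : 0 <= K * (size ps)%:R * rho `^ s.
      by rewrite !mulr_ge0 ?powR_ge0// (le_trans _ K1).
    rewrite -mulrA ler_wpM2l//.
    have u1 : 0 <= a `^ s * rho `^ (2 - s) / a ^+ 2 <= 1.
      rewrite divr_ge0 ?sqr_ge0 ?(mulr_ge0 (powR_ge0 _ _) (powR_ge0 _ _))//=.
      by rewrite ler_pdivrMr ?exprn_gt0// mul1r.
    by nra.
  have q0 : 0 <= (size ps)%:R * rho `^ s by rewrite mulr_ge0 ?powR_ge0.
  apply: (@le_trans _ _ ((size ps)%:R * (theta * rho `^ s))).
    by rewrite ler_wpM2r ?mulr_ge0 ?powR_ge0 ?(ltW theta0)// ler_nat count_size.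
  have : theta * ((size ps)%:R * rho `^ s) <= K * ((size ps)%:R * rho `^ s) / 2.
    by move: (_ * rho `^ s) q0 => q q0; nra.
  by rewrite mulrCA mulrA (mulrA K).
move=> x; rewrite szE natrM.
apply: (@le_trans _ _ ((size ps)%:R * (M%:R * (C * (a' / a) ^+ 2 + theta * a' `^ s)))).
  rewrite -(count_predT ps); apply: count_flatten_le (bound_ge0 a') _ _ => // p.
  by have [_ _ /(_ x a' (lexx _))] := fP p.
rewrite pow2// mulrA [leRHS](_ : _ = (size ps)%:R * M%:R * (K * eps' * a' `^ s)); last by ring.
rewrite ler_wpM2l ?mulr_ge0//.
rewrite (_ : C * _ = a' `^ s * (D * a' `^ (2 - s))); last by rewrite /D; ring.
have hr : D * a' `^ (2 - s) <= eps' / 2.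
  rewrite mulrC -ler_pdivlMr//.
  rewrite (_ : eps' / 2 / D = t `^ (2 - s)).
    by apply: ge0_ler_powR; rewrite ?nnegrE// ltW// subr_gt0.
  rewrite /t -powRrM mulVf ?powRr1 ?(divr_ge0 (ltW e0) (mulr_ge0 _ (ltW D0)))//; last first.
    by rewrite gt_eqF// subr_gt0.
  by rewrite -mulrA -invfM.
have Ke : eps' <= K * eps' by rewrite ler_peMl// ltW.
rewrite [X in X + _]mulrC -mulrDl ler_wpM2r ?powR_ge0//.
by apply: (@le_trans _ _ eps') => //; lra.
Qed.

End Cantor.

(** * Finite covers of the Cantor set *)

Section CantorCover.
Local Open Scope classical_set_scope.
Context {R : realType} {X : normedModType R}.
Hypothesis compact_cball : forall (x : X) (r : R), compact [set y | `|y - x| <= r].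

Lemma closed_normB_le (x : X) (r : R) : closed [set y : X | `|y - x| <= r].
Proof.
apply: (@closed_comp _ _ (fun y : X => `|y - x|) [set t : R | t <= r]).
  by move=> y _; apply: cvg_norm; apply: cvgB; [exact: cvg_id|exact: cvg_cst].
exact: closed_le.
Qed.

Lemma closed_ex_normB_le (ps : seq X) (r : R) :
  closed [set y : X | exists2 p, p \in ps & `|y - p| <= r].
Proof.
elim: ps => [|p ps IH].
  rewrite (_ : [set _ | _] = set0); first exact: closed0.
  by apply/seteqP; split => // y [].
rewrite (_ : [set _ | _] = [set y | `|y - p| <= r] `|`
    [set y | exists2 p, p \in ps & `|y - p| <= r]).
  by apply: closedU => //; exact: closed_normB_le.
apply/seteqP; split => y /=.
  by move=> [q]; rewrite inE => /orP[/eqP ->|qps] h; [left|right; exists q].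
by move=> [h|[q qps h]]; [exists p|exists q] => //; rewrite inE ?eqxx// qps orbT.
Qed.

(** Each [i] is the 2-adic valuation of arbitrarily large numbers, so the construction can return to
    the [i]-th family infinitely often. *)
Lemma logn2_odd_mul i j : logn 2 (2 ^ i * j.*2.+1) = i.
Proof.
rewrite lognM ?expn_gt0// pfactorK// (_ : logn 2 _.+1 = 0%N) ?addn0//.
by apply/eqP; rewrite lognE /= dvdn2 /= odd_double.
Qed.

(** The generations are nested finite unions of closed balls, and a point of all of them lies
    infinitely often in every family. If open balls cover these points, finitely many of them cover
    a whole generation; the Frostman bound, summed over them, has to account for every centre. *)
Lemma cantor_cover (s : R) (V : nat -> nat -> set X) (p0 : X) (a0 : R) :
  0 < s < 2 -> 0 < a0 -> (forall i, ubiquitous s (V i)) ->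
  exists2 K : R, 0 < K & forall (x : nat -> X) (rho : nat -> R),
    (forall i, 0 < rho i) ->
    (forall y, `|y - p0| <= a0 ->
      (forall i N, exists2 n, (N <= n)%N & V i n y) ->
      exists i, `|y - x i| < rho i) ->
    exists k, 1 <= K * \sum_(i < k) rho i `^ s.
Proof.
move=> s02 a0_gt0 ubiV.
have /choice[C0 /all_and2[C0_gt0 ubi]] : forall i, exists C : R, 0 < C /\ ubiquitous_with C s (V i).
  by move=> i; have [C] := ubiV i; exists C.
(* idx takes every value infinitely often *)
pose idx k := logn 2 k.+1; pose C k := C0 (idx k).
(* The gain needed against the constant of the family treated at step [k]. *)
pose eps k := (2 * C k)^-1.
have eps0 k : 0 < eps k by rewrite invr_gt0 mulr_gt0// C0_gt0.
have s_gt0 : 0 < s by case/andP: s02.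
(* The last two terms let the single ball of generation 0 satisfy the two counting bounds of
   [spread]. *)
pose K := Num.max 1 (Num.max (a0 `^ s)^-1 (eps 0%N * a0 `^ s)^-1).
have K1 : 1 <= K by rewrite le_max lexx.
have base : spread s K (eps 0%N) [:: p0] a0.
  have pa : 0 < a0 `^ s by rewrite powR_gt0.
  split => // [x rho arho|x] /=.
    have r0 : 0 < rho by apply: lt_le_trans arho.
    rewrite mulr1; apply: (@le_trans _ _ 1); first by rewrite lern1; case: (_ <= _).
    rewrite -ler_pdivrMr ?powR_gt0// div1r.
    rewrite /K !le_max; apply/orP; right; apply/orP; left.
    rewrite lef_pV2 ?posrE ?powR_gt0//.
    by apply: ge0_ler_powR; rewrite ?nnegrE ?(ltW s_gt0) ?(ltW r0) ?(ltW a0_gt0).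
  rewrite mulr1; apply: (@le_trans _ _ 1); first by rewrite lern1; case: (_ <= _).
  rewrite -mulrA -ler_pdivrMr ?mulr_gt0// div1r.
  by rewrite /K !le_max lexx !orbT.
(* [spread] is a premise under the existential, so that [choice] yields a total step function,
   arbitrary on bad states. *)
have /choice[nxt nxtP] : forall kst : nat * (seq X * R), exists st' : seq X * R,
    spread s K (eps kst.1) kst.2.1 kst.2.2 ->
    [/\ spread s K (eps kst.1.+1) st'.1 st'.2, st'.2 <= kst.1.+1%:R^-1 &
      exists2 n, (kst.1 <= n)%N & forall c, c \in st'.1 ->
      (exists2 p, p \in kst.2.1 & `|c - p| + st'.2 <= kst.2.2) /\
      forall y, `|y - c| <= st'.2 -> V (idx kst.1) n y].
  move=> [k [ps a]] /=.
  have [sp|nsp] := pselect (spread s K (eps k) ps a); last by exists (ps, a).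
  have eC : eps k * C k <= 2^-1.
    by rewrite /eps invfM -mulrA mulVf ?mulr1// gt_eqF// C0_gt0.
  have [|ps' [a' [n [sp' kn a'k h]]]] :=
    spread_step k (eta := k.+1%:R^-1) s02 K1 (eps0 k.+1) (C0_gt0 _) eC _ sp (ubi (idx k)).
    by rewrite invr_gt0 ltr0Sn.
  by exists (ps', a') => _; split => //; exists n.
pose st := fix st k := if k is k'.+1 then nxt (k', st k') else ([:: p0], a0).
have stP k : spread s K (eps k) (st k).1 (st k).2.
  by elim: k => [|k IH]; [exact: base|have [] := nxtP (k, st k) IH].
pose cover k := [set y : X | exists2 p, p \in (st k).1 & `|y - p| <= (st k).2].
have coverS k : cover k.+1 `<=` cover k.
  move=> y [c cst yc]; have [_ _ [n _ /(_ c cst)[[p pst cp] _]]] := nxtP (k, st k) (stP k).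
  exists p => //; apply: le_trans cp.
  by rewrite (le_trans (ler_distD c y p))// addrC lerD2l.
have coverM j k : (j <= k)%N -> cover k `<=` cover j.
  by move=> /subnK <-; elim: (k - j)%N => [//|d IH] y /coverS /IH.
have limP y : (forall k, cover k y) -> forall i N, exists2 n, (N <= n)%N & V i n y.
  (* This step treats the family [i], the factor [N.*2.+1] being odd, and comes no earlier than step
     [N]. *)
  move=> hy i N; pose k := (2 ^ i * N.*2.+1).-1.
  have kE : k.+1 = (2 ^ i * N.*2.+1)%N by rewrite prednK// muln_gt0 expn_gt0.
  have [c cst yc] := hy k.+1.
  have [_ _ [n kn /(_ c cst)[_ /(_ y yc)]]] := nxtP (k, st k) (stP k).
  rewrite /= /idx kE logn2_odd_mul => Vn; exists n => //; apply: leq_trans kn.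
  rewrite -ltnS kE; apply: leq_trans (_ : N.*2.+1 <= _)%N.
    by rewrite ltnS -addnn leq_addr.
  by rewrite leq_pmull// expn_gt0.
exists K => [|x rho rho0 cov]; first exact: lt_le_trans K1.
(* Otherwise each generation [k] has a point outside the first [k] balls. A cluster point of these
   lies in every generation, hence in some open ball, which the tail of the sequence avoids. *)
have [k kP] : exists k, forall y, cover k y -> exists2 i, (i < k)%N & `|y - x i| < rho i.
  apply: contrapT => /forallNP/= nk.
  have /choice[y yP] : forall k, exists y, cover k y /\ forall i, (i < k)%N -> rho i <= `|y - x i|.
    move=> k; have /existsNP[y /not_implyP[yk ny]] := nk k.
    exists y; split => // i ik; rewrite leNgt; apply/negP => h.
    by apply: ny; exists i.
  have tail k : (y @ \oo) [set z | exists2 j, (k <= j)%N & z = y j].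
    by exists k => // j /= kj; exists j.
  have [z [z0 zP]] : [set u | `|u - p0| <= a0] `&` cluster (y @ \oo) !=set0.
    apply: compact_cball; exists 0%N => // j _ /=.
    have := coverM 0%N j (leq0n _) _ (yP j).1.
    by case=> p; rewrite /= inE => /eqP ->.
  have [|i zi] := cov z z0.
    apply: limP => k; rewrite -/(cover k z).
    suff : closure (cover k) z by apply: closed_ex_normB_le.
    move=> B /(zP _ _ (tail k)) [_ [[j kj ->] By]].
    by exists (y j); split => //; apply: coverM kj _ (yP j).1.
  have nz : nbhs z [set u | `|u - x i| < rho i].
    apply: open_nbhs_nbhs; split => //.
    apply: (@open_comp _ _ (fun u : X => `|u - x i|) [set t : R | t < rho i]).
      by move=> u _; apply: cvg_norm; apply: cvgB; [exact: cvg_id|exact: cvg_cst].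
    exact: open_lt.
  have [_ [[j ij ->] /=]] := zP _ _ (tail i.+1) nz.
  by rewrite ltNge (yP j).2.
(* The Frostman bound holds only at scales at least the radius of the generation, so a later
   generation is taken, finer than all [k] balls. *)
have [k' kk' small] : exists2 k', (k <= k')%N & forall i, (i < k)%N -> (st k').2 <= rho i.
  pose m := \big[Num.min/1]_(i < k) rho i.
  have m0 : 0 < m by apply: lt_bigmin.
  have [k0 k0m] : exists k0 : nat, k0.+1%:R^-1 <= m.
    by have [k0] := ltr_add_invr m0; rewrite add0r => /ltW; exists k0.
  exists (maxn k k0).+1; first by rewrite leqW// leq_maxl.
  move=> i ik; apply: (@le_trans _ _ m); last exact: (bigmin_le _ (Ordinal ik)).
  have [_ h _] := nxtP (maxn k k0, st (maxn k k0)) (stP (maxn k k0)).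
  apply: le_trans h _; apply: le_trans k0m.
  by rewrite lef_pV2 ?posrE ?ltr0Sn// ler_nat ltnS leq_maxr.
have [_ N_gt0 large _] := stP k'.
exists k; set N := size (st k').1 in N_gt0.
have Nr : 0 < N%:R :> R by rewrite ltr0n.
rewrite -(ler_pM2l Nr) mulr1 mulrCA mulr_sumr mulr_sumr.
apply: (@le_trans _ _ (\sum_(i < k) (count (fun p => `|p - x i| <= rho i + (st k').2) (st k').1)%:R)).
  rewrite -natr_sum ler_nat.
  rewrite /N -(count_predT (st k').1).
  have {}sub p : p \in (st k').1 -> exists2 i : 'I_k, true & `|p - x i| <= rho i + (st k').2.
    have [a'0 _ _ _] := stP k'.
    move=> pst; have [|i ik pi] := kP p.
      by apply: coverM kk' _ _; exists p => //; rewrite subrr normr0 ltW.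
    by exists (Ordinal ik) => //=; rewrite (le_trans (ltW pi))// lerDl ltW.
  elim: (st k').1 sub => [|p ps' IH] sub; first by rewrite /= big1.
  rewrite /= big_split /= add1n; have [i _ pi] := sub p (mem_head _ _).
  rewrite (bigD1 i)//= pi !add1n addSn ltnS (leq_trans (IH _)) ?leq_addl//.
  by move=> q qps; apply: sub; rewrite inE qps orbT.
apply: ler_sum => i _; rewrite mulrA; apply: large; exact: small.
Qed.
End CantorCover.

(** * Hausdorff contents *)

Section Hausdorff.
Local Open Scope classical_set_scope.
Context {R : realType}.

Section Gauge.
Context {X : Type} (d : X -> X -> R).

Lemma diameter_ge (U : set X) x y : U x -> U y -> ((d x y)%:E <= diameter d U)%E.
Proof. by move=> Ux Uy; apply: ereal_sup_ubound; exists x => //; exists y. Qed.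

Lemma hausdorff_gauge_ge0 (s : R) (U : set X) : (0 <= hausdorff_gauge d s U)%E.
Proof. by rewrite /hausdorff_gauge; case: ifP => // _; exact: poweR_ge0. Qed.

Lemma hausdorff_content_ge0 (s delta : R) (E : set X) : (0 <= hausdorff_content d s delta E)%E.
Proof.
apply: le_ereal_inf_tmp => _ [U _ <-]; apply: nneseries_ge0 => i _ _.
exact: hausdorff_gauge_ge0.
Qed.

Lemma hausdorff_content_le_measure (s delta : R) (E : set X) : 0 < delta ->
  (hausdorff_content d s delta E <= hausdorff_measure d s E)%E.
Proof. by move=> d0; apply: ereal_sup_ubound; exists delta. Qed.

End Gauge.

Section Expanding.
Context {X Y : Type} (dX : X -> X -> R) (dY : Y -> Y -> R) (phi : X -> Y).
Variables (S : set X) (E : set Y).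
Hypothesis dX_ge0 : forall u v, 0 <= dX u v.
Hypothesis phiS : forall u, S u -> E (phi u).
Hypothesis phi_le : forall u v, S u -> S v -> dX u v <= dY (phi u) (phi v).

(** A cover of [E] pulls back along [phi] without increasing diameters, and for diameters at most 1
    the larger exponent gives the smaller gauge. *)
Lemma hausdorff_content1_le (s t : R) : 0 <= t <= s ->
  (hausdorff_content dX s 1 S <= hausdorff_content dY t 1 E)%E.
Proof.
move=> /andP[t0 ts]; apply: le_ereal_inf_tmp => _ [U [EU U1] <-].
pose U' i := S `&` phi @^-1` U i.
have dU i : (diameter dX (U' i) <= diameter dY (U i))%E.
  apply: ge_ereal_sup => _ [x [Sx Ux] [y [Sy Uy] <-]].
  by apply: (@le_trans _ _ (dY (phi x) (phi y))%:E); [rewrite lee_fin phi_le|exact: diameter_ge].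
apply: (@le_trans _ _ (\sum_(0 <= i <oo) hausdorff_gauge dX s (U' i))%E).
  apply: ereal_inf_lbound; exists U' => //; split => [x Sx|i]; last exact: le_trans (U1 i).
  by have [i _ Ui] := EU _ (phiS Sx); exists i.
apply: lee_nneseries => [i _ _|i _]; first exact: hausdorff_gauge_ge0.
rewrite {1}/hausdorff_gauge; case: ifPn => [_|/set0P[x U'x]]; first exact: hausdorff_gauge_ge0.
have UN0 : U i != set0 by apply/set0P; exists (phi x); case: U'x.
rewrite /hausdorff_gauge (negPf UN0).
have dU0 : (0 <= diameter dX (U' i))%E.
  by apply: le_trans (diameter_ge dX U'x U'x); rewrite lee_fin.
move: (dU i) (U1 i) dU0.
case: (diameter dX _) => [x'| |]; case: (diameter dY _) => [y'| |] //.
rewrite !poweR_EFin !lee_fin => xy y1 x0.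
apply: (@le_trans _ _ (y' `^ s)).
  by apply: ge0_ler_powR => //; rewrite ?nnegrE ?(le_trans t0 ts) ?(le_trans x0 xy).
(* Diameter 0 is treated apart because the power 0^0 is 1. *)
have [->|yN0] := eqVneq y' 0.
  have [s_0|sN0] := eqVneq s 0; last by rewrite powR0// powR_ge0.
  by rewrite s_0 powRr0 (_ : t = 0) ?powRr0//; lra.
by apply: ger_powR => //; rewrite y1 andbT lt_neqAle eq_sym yN0 (le_trans x0 xy).
Qed.

End Expanding.

(** An exponent [t < s0] of measure zero would give zero content on [S] at the midpoint of [t] and
    [s0]. The midpoint replaces [t] because [t] may be 0, while contents are controlled at positive
    exponents only. *)
Lemma hausdorff_dim_ge {X Y : Type} (dX : X -> X -> R) (dY : Y -> Y -> R) (phi : X -> Y)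
    (S : set X) (E : set Y) (s0 : R) :
  (forall u v, 0 <= dX u v) -> (forall u, S u -> E (phi u)) ->
  (forall u v, S u -> S v -> dX u v <= dY (phi u) (phi v)) ->
  (forall s, 0 < s < s0 -> (0 < hausdorff_content dX s 1 S)%E) ->
  (s0%:E <= hausdorff_dim dY E)%E.
Proof.
move=> d0 phiS phi_le S_gt0; apply: le_ereal_inf_tmp => _ [t [t0 tE] <-].
rewrite lee_fin leNgt; apply/negP => ts.
have ht : 0 < (t + s0) / 2 < s0 by apply/andP; split; lra.
have := S_gt0 _ ht; apply/negP; rewrite -leNgt -tE.
apply: (le_trans (hausdorff_content1_le (s := (t + s0) / 2) (t := t) d0 phiS phi_le _)).
  by apply/andP; split => //; lra.
exact: hausdorff_content_le_measure.
Qed.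

(** Each set of a cheap cover is enlarged to an open ball at the cost of a summable slack. The total
    stays below [2 * e], half of the minimum [K^-1] that the hypothesis imposes on covers by
    balls. *)
Lemma hausdorff_content_gt0 (X : normedModType R) (d : X -> X -> R) (S : set X) (s K : R) :
  (forall x y, `|x - y| <= d x y) -> 0 < s -> 0 < K ->
  (forall (x : nat -> X) (rho : nat -> R), (forall i, 0 < rho i) ->
     (forall y, S y -> exists i, `|y - x i| < rho i) ->
     exists k, 1 <= K * \sum_(i < k) rho i `^ s) ->
  (0 < hausdorff_content d s 1 S)%E.
Proof.
move=> normd s0 K0 cov; rewrite lt_neqAle hausdorff_content_ge0 andbT.
apply/negP => /eqP cont0.
pose e : R := (4 * K)^-1.
have e0 : 0 < e by rewrite invr_gt0 mulr_gt0.
have : (hausdorff_content d s 1 S < e%:E)%E by rewrite -cont0 lte_fin.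
move=> /ereal_inf_lt[_ [U [SU U1] <-] Ue].
have pow_half i : 0 < e / 2 ^+ i.+1 by rewrite divr_gt0// exprn_gt0.
have ball_of i : exists xr : X * R, [/\ 0 < xr.2,
    forall y, U i y -> `|y - xr.1| < xr.2 &
    ((xr.2 `^ s)%:E <= hausdorff_gauge d s (U i) + (e / 2 ^+ i.+1)%:E)%E].
  have sV : s^-1 != 0 by rewrite invr_eq0 gt_eqF.
  have powK (a : R) : 0 <= a -> (a `^ s^-1) `^ s = a.
    by move=> a0; rewrite -powRrM mulVf ?powRr1// gt_eqF.
  rewrite /hausdorff_gauge; case: ifPn => [/eqP ->|/set0P[x Ux]].
    (* An empty set also needs a ball of positive radius, which uses up exactly its slack. *)
    exists (0, (e / 2 ^+ i.+1) `^ s^-1) => /=; split => //.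
      by rewrite powR_gt0.
    by rewrite add0e powK// ltW.
  have dU0 : (0 <= diameter d (U i))%E.
    by apply: le_trans (diameter_ge d Ux Ux); rewrite lee_fin (le_trans _ (normd _ _)).
  have := diameter_ge d (U := U i); move: (U1 i) dU0.
  case: (diameter d _) => [r| |] // r1; rewrite lee_fin => r0 rP.
  have s_ge0 : 0 < r `^ s + e / 2 ^+ i.+1 by rewrite ltr_wpDl// powR_ge0.
  exists (x, (r `^ s + e / 2 ^+ i.+1) `^ s^-1) => /=; split => //.
  - by rewrite powR_gt0.
  - move=> y Uy; apply: (@le_lt_trans _ _ r).
      by apply: le_trans (normd _ _) _; rewrite -lee_fin; exact: rP.
    have {1}-> : r = (r `^ s) `^ s^-1 by rewrite -powRrM mulfV ?powRr1// gt_eqF.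
    by apply: gt0_ltr_powR; rewrite ?invr_gt0 ?nnegrE ?powR_ge0 ?(ltW s_ge0)// ltrDl.
  - by rewrite -EFinD lee_fin powK// ltW.
have /choice[xr xrP] := ball_of.
have [|y Sy|k] := cov (fun i => (xr i).1) (fun i => (xr i).2).
- by move=> i; have [] := xrP i.
- by have [i _ Uiy] := SU y Sy; exists i; have [_ /(_ y Uiy)] := xrP i.
apply/negP; rewrite -ltNge.
suff : \sum_(i < k) (xr i).2 `^ s < 2 * e.
  have Ki : 0 < K^-1 by rewrite invr_gt0.
  by move=> h; rewrite mulrC -ltr_pdivlMr// (lt_trans h)// /e invfM mul1r; lra.
rewrite -lte_fin -sumEFin.
apply: (@le_lt_trans _ _ (\sum_(i < k) (hausdorff_gauge d s (U i) + (e / 2 ^+ i.+1)%:E))%E).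
  by apply: lee_sum => i _; have [] := xrP i.
rewrite big_split /= (_ : 2 * e = e + e); last by ring.
rewrite EFinD; apply: lte_leD; [by rewrite sumEFin| |].
  apply: le_lt_trans Ue; rewrite -(big_mkord xpredT (fun i => hausdorff_gauge d s (U i))).
  by apply: nneseries_lim_ge => i _ _; exact: hausdorff_gauge_ge0.
have geom : \sum_(i < k) e / 2 ^+ i.+1 = e - e / 2 ^+ k.
  elim: k => [|k IH]; first by rewrite big_ord0 expr0 divr1 subrr.
  by rewrite big_ord_recr /= IH exprS; field; rewrite expf_neq0.
by rewrite sumEFin lee_fin geom gerBl divr_ge0 ?exprn_ge0// ltW.
Qed.

End Hausdorff.

(** * Null limsup sets *)

Section LimsupUpper.
Local Open Scope classical_set_scope.
Context {R : realType}.

Lemma geometric_le (C q e : R) : 0 <= C -> 0 <= q < 1 -> 0 < e ->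
  exists n0, forall n, (n0 <= n)%N -> C * q ^+ n <= e.
Proof.
move=> C0 /andP[q0 q1] e0.
have /cvgrPdist_le/(_ _ e0)[n0 _ h] : (fun n => C * q ^+ n : R^o) @ \oo --> (0 : R^o).
  by have := @cvg_geometric R C q; rewrite ger0_norm//; apply.
exists n0 => n /h /=; rewrite sub0r normrN ger0_norm ?mulr_ge0 ?exprn_ge0//.
Qed.

Lemma sum_geometric_le (C q : R) k : 0 <= C -> 0 <= q < 1 ->
  \sum_(i < k) C * q ^+ i <= C / (1 - q).
Proof.
move=> C0 /andP[q0 q1]; rewrite -mulr_sumr ler_wpM2l// -[leRHS]mul1r ler_pdivlMr ?subr_gt0//.
by rewrite -opprB mulrN mulrC -subrX1 opprB gerBl exprn_ge0.
Qed.

Lemma sumr_ltn_le (c : R) (N k : nat) : 0 <= c ->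
  \sum_(j < k | (j < N)%N) c <= N%:R * c.
Proof.
move=> c0; apply: (@le_trans _ _ ((minn k N)%:R * c)); last first.
  by rewrite ler_wpM2r// ler_nat geq_minr.
elim: k => [|k IH]; first by rewrite big_ord0 mulr_ge0.
rewrite big_mkcond big_ord_recr -big_mkcond /=.
apply: (le_trans (lerD IH (lexx _))); case: ifP => kN.
  by rewrite -[X in _ + X]mul1r -mulrDl natr1 ler_wpM2r// ler_nat; lia.
by rewrite addr0 ler_wpM2r// ler_nat; lia.
Qed.

Lemma nneseries_le (u : nat -> \bar R) (c : \bar R) : (forall i, (0 <= u i)%E) ->
  (forall k, (\sum_(i < k) u i <= c)%E) -> (\sum_(0 <= i <oo) u i <= c)%E.
Proof.
move=> u0 uc; apply: lime_le; first by apply: is_cvg_nneseries.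
by apply: nearW => k; rewrite big_mkord.
Qed.

(** A Borel-Cantelli argument: the sets of all times from [n0] on cover [E], are small by the bound
    on [D], and their gauges sum to the tail of a geometric series. *)
Lemma hausdorff_measure_limsup0 (X : Type) (d : X -> X -> R) (E : set X) (s : R)
    (N : nat -> nat) (D : nat -> R) (W : nat -> nat -> set X) (C1 q1 C2 q2 : R) :
  0 < s -> (forall x y, 0 <= d x y) ->
  0 <= C1 -> 0 <= q1 < 1 -> 0 <= C2 -> 0 <= q2 < 1 ->
  (forall n, 0 <= D n <= C1 * q1 ^+ n) ->
  (forall n, (N n)%:R * D n `^ s <= C2 * q2 ^+ n) ->
  (forall n j x y, W n j x -> W n j y -> d x y <= D n) ->
  (forall x n0, E x -> exists2 n, (n0 <= n)%N & exists2 j, (j < N n)%N & W n j x) ->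
  hausdorff_measure d s E = 0%E.
Proof.
move=> s0 d0 C10 q11 C20 q21 Dle ND Wd WE; apply/eqP; rewrite eq_le; apply/andP; split; last first.
  exact: le_trans (hausdorff_content_ge0 _ _ _ _) (hausdorff_content_le_measure _ _ _ (@ltr01 R)).
apply: ge_ereal_sup => _ [delta /= delta0 <-]; apply/lee_addgt0Pr => e e0; rewrite add0e.
have q2' : 0 < 1 - q2 by case/andP: q21 => _; rewrite subr_gt0.
have [n1 n1P] := geometric_le C10 q11 delta0.
have [n2 n2P] := geometric_le C20 q21 (mulr_gt0 e0 q2').
pose n0 := maxn n1 n2.
(* Padding with empty sets, of gauge 0, lets the cover be indexed by all pairs of naturals. *)
pose U' n j := if (j < N (n0 + n))%N then W (n0 + n)%N j else set0.
have gU' n j : (hausdorff_gauge d s (U' n j) <=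
    if (j < N (n0 + n))%N then (D (n0 + n)%N `^ s)%:E else 0)%E.
  rewrite /U'; case: ifP => _; last by rewrite /hausdorff_gauge eqxx.
  rewrite /hausdorff_gauge; case: ifPn => [_|/set0P[x Wx]]; first by rewrite lee_fin powR_ge0.
  have d1 : (0 <= diameter d (W (n0 + n)%N j))%E.
    by apply: le_trans (diameter_ge d Wx Wx); rewrite lee_fin.
  have d2 : (diameter d (W (n0 + n)%N j) <= (D (n0 + n)%N)%:E)%E.
    by apply: ge_ereal_sup => _ [y Wy [z Wz <-]]; rewrite lee_fin; exact: Wd Wy Wz.
  move: d1 d2; case: (diameter d _) => [r| |] //.
  rewrite poweR_EFin !lee_fin => r0 rD.
  by apply: ge0_ler_powR; rewrite ?nnegrE ?(ltW s0) ?(le_trans r0 rD).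
have sumU' n : (\sum_(0 <= j <oo) hausdorff_gauge d s (U' n j) <= (C2 * q2 ^+ (n0 + n))%:E)%E.
  apply: nneseries_le => [j|k]; first exact: hausdorff_gauge_ge0.
  apply: le_trans (_ : (\sum_(j < k | (j < N (n0 + n)%N)%N) (D (n0 + n)%N `^ s)%:E <= _)%E).
    by rewrite [leRHS]big_mkcond/=; apply: lee_sum => j _; exact: gU'.
  rewrite sumEFin lee_fin; apply: le_trans (ND _).
  exact: sumr_ltn_le (powR_ge0 _ _).
(* A content is computed on sequences, so the double family is enumerated along a bijection of [nat]
   with its square. *)
have /card_esym/ppcard_eqP[f] := card_nat2.
pose U i := U' (f i).1 (f i).2.
apply: (@le_trans _ _ (\sum_(0 <= i <oo) hausdorff_gauge d s (U i))%E).
  apply: ereal_inf_lbound; exists U => //; split => [x Ex|i].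
    have [n n0n [j jN Wx]] := WE x n0 Ex.
    have [i _ fi] := @surj _ _ _ _ f (n - n0, j)%N I.
    by exists i => //; rewrite /U fi /U' /= subnKC// jN.
  apply: ge_ereal_sup => _ [y Uy [z Uz <-]]; move: Uy Uz.
  rewrite /U /U'; case: ifP => // _ Wy Wz; rewrite lee_fin.
  apply: (le_trans (Wd _ _ _ _ Wy Wz)); have /andP[_ h] := Dle (n0 + (f i).1)%N.
  by apply: (le_trans h); apply: n1P; rewrite (leq_trans (leq_maxl _ n2))// leq_addr.
rewrite nneseries_esum; last by move=> *; exact: hausdorff_gauge_ge0.
rewrite (_ : [set x | xpredT x] = setT); last by apply/seteqP.
pose g n j := hausdorff_gauge d s (U' n j).
rewrite (_ : esum _ _ = \esum_(k in [set: nat] `*`` (fun=> [set: nat])) g k.1 k.2); last first.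
  rewrite (@reindex_esum _ _ _ setT _ f)//.
  rewrite (_ : _ `*`` _ = setT); last by apply/seteqP.
  exact: bij.
rewrite -esum_esum; last by move=> *; exact: hausdorff_gauge_ge0.
have -> : \esum_(i in [set: nat]) \esum_(j in [set: nat]) g i j =
    (\sum_(0 <= i <oo) \sum_(0 <= j <oo) g i j)%E.
  rewrite nneseries_esum; last by move=> *; apply: nneseries_ge0 => *; exact: hausdorff_gauge_ge0.
  rewrite (_ : [set x | xpredT x] = setT); last by apply/seteqP.
  apply: eq_esum => i _; rewrite nneseries_esum; last by move=> *; exact: hausdorff_gauge_ge0.
  by rewrite (_ : [set x | xpredT x] = setT)//; apply/seteqP.
apply: nneseries_le => [n|k]; first by apply: nneseries_ge0 => *; exact: hausdorff_gauge_ge0.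
apply: (@le_trans _ _ (\sum_(i < k) (C2 * q2 ^+ n0 * q2 ^+ i)%:E)%E).
  by apply: lee_sum => i _; rewrite -mulrA -exprD; exact: sumU'.
have Cq : 0 <= C2 * q2 ^+ n0 by rewrite mulr_ge0// exprn_ge0//; case/andP: q21.
rewrite sumEFin lee_fin (le_trans (sum_geometric_le k Cq q21))//.
by rewrite ler_pdivrMr//; apply: n2P; rewrite leq_maxr.
Qed.

End LimsupUpper.

(** * Similarities of the plane *)

Section Plane.
Local Open Scope classical_set_scope.
Context {R : realType}.

Lemma cV_norm_le n (u : 'cV[R]_n) (r : R) : 0 <= r ->
  reflect (forall i, `|u i 0| <= r) (`|u| <= r).
Proof.
move=> r0; rewrite [`|u|]/Num.Def.normr/= mx_normrE; apply: (iffP (bigmax_leP _ _ _ _)).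
  by move=> [_ h] i; exact: (h (i, 0)).
by move=> h; split => // -[i j] _; rewrite /= ord1.
Qed.

Lemma cV_coord_le n (u : 'cV[R]_n) i : `|u i 0| <= `|u|.
Proof. by have /cV_norm_le := lexx `|u|; apply. Qed.

Lemma cV_compact_cball n (x : 'cV[R]_n) (r : R) : compact [set y | `|y - x| <= r].
Proof.
have [r0|r0] := ltP r 0.
  rewrite (_ : [set _ | _] = set0); first exact: compact0.
  by apply/seteqP; split => // y /=; rewrite leNgt (lt_le_trans r0).
rewrite (_ : [set _ | _] =
    trmx @` [set v : 'rV[R]_n | forall i, `[x i 0 - r, x i 0 + r] (v ord0 i)]).
  apply: continuous_compact; last by apply: (rV_compact (A := fun i => _)) => i; exact: segment_compact.
  apply: continuous_subspaceT => M s /= /nbhs_ballP[e e0 es].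
  by apply/nbhs_ballP; exists e => //= N [_ MN]; apply: es; split => // i j; rewrite !mxE.
apply/seteqP; split => [y /(cV_norm_le _ r0) h|_ [v h <-]].
  exists y^T; rewrite ?trmxK// => i /=; rewrite in_itv/= mxE.
  by have := h i; rewrite !mxE ler_distl.
by apply/(cV_norm_le _ r0) => i; have := h i; rewrite /= in_itv/= !mxE ler_distl.
Qed.

Lemma edist_ge0 n (u v : 'cV[R]_n) : 0 <= edist u v.
Proof. exact: sqrtr_ge0. Qed.

Lemma sqr_edist n (u v : 'cV[R]_n) : edist u v ^+ 2 = \sum_i (u i 0 - v i 0) ^+ 2.
Proof. by rewrite sqr_sqrtr// sumr_ge0// => i _; exact: sqr_ge0. Qed.

Lemma edistB n (u v : 'cV[R]_n) : edist u v = edist (u - v) 0.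
Proof. by congr Num.sqrt; apply: eq_bigr => i _; rewrite !mxE subr0. Qed.

Lemma norm_le_edist n (u v : 'cV[R]_n) : `|u - v| <= edist u v.
Proof.
apply/cV_norm_le => [|i]; first exact: edist_ge0.
rewrite -sqrtr_sqr !mxE ler_wsqrtr// (bigD1 i)//= lerDl sumr_ge0// => j _.
exact: sqr_ge0.
Qed.

Lemma edist_le_norm (u v : 'cV[R]_2) : edist u v <= 2 * `|u - v|.
Proof.
rewrite -(@ler_pXn2r _ 2) ?nnegrE ?edist_ge0 ?mulr_ge0// sqr_edist.
have h i : (u i 0 - v i 0) ^+ 2 <= `|u - v| ^+ 2.
  by have := cV_coord_le (u - v) i; rewrite !mxE -(@ler_pXn2r _ 2) ?nnegrE// real_normK// num_real.
apply: (le_trans (ler_sum _ (fun i _ => h i))).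
rewrite sumr_const card_ord exprMn -[leLHS]mulr_natl ler_wpM2r ?sqr_ge0//.
by rewrite -natrX ler_nat.
Qed.

(** By polarisation [g] preserves the inner product. The matrix [G] of the images of the basis is
    then orthogonal and [G^T *m g u = u], so [G^T *m w] is a preimage of [w]. This makes every
    similarity onto, which its definition does not say. *)
Lemma isometry0_surj n (g : 'cV[R]_n -> 'cV[R]_n) : g 0 = 0 ->
  (forall u v, edist (g u) (g v) = edist u v) -> forall w, exists u, g u = w.
Proof.
move=> g0 gE w.
pose dot (u v : 'cV[R]_n) := \sum_i u i 0 * v i 0.
have dotE u v : dot u v = (edist u 0 ^+ 2 + edist v 0 ^+ 2 - edist u v ^+ 2) / 2.
  rewrite !sqr_edist -big_split -sumrB mulr_suml; apply: eq_bigr => i _ /=.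
  by rewrite !mxE; field.
have gdot u v : dot (g u) (g v) = dot u v.
  by rewrite !dotE -[X in edist (g u) X]g0 -[X in edist (g v) X]g0 !gE.
pose G : 'M[R]_n := \matrix_(i, j) g (delta_mx j 0) i 0.
have dot_delta i u : dot (delta_mx i 0) u = u i 0.
  rewrite /dot (bigD1 i)//= mxE !eqxx mul1r big1 ?addr0// => j ji.
  by rewrite mxE (negPf ji) mul0r.
have GTg u : G^T *m g u = u.
  apply/colP => i; rewrite -(dot_delta i u) -gdot mxE.
  by apply: eq_bigr => j _; rewrite !mxE.
have GTG : G^T *m G = 1%:M.
  apply/matrixP => i j; rewrite !mxE.
  transitivity (dot (g (delta_mx i 0)) (g (delta_mx j 0))).
    by apply: eq_bigr => k _; rewrite !mxE.
  by rewrite gdot dot_delta !mxE eqxx andbT.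
exists (G^T *m w).
by rewrite -[LHS]mul1mx -(mulmx1C GTG) -mulmxA GTg mulmxA (mulmx1C GTG) mul1mx.
Qed.

Lemma similarity_surj n (f : 'cV[R]_n -> 'cV[R]_n) : similarity f ->
  forall y, exists x, f x = y.
Proof.
move=> [c c0 fc] y.
have [| |u] := @isometry0_surj n (fun u => c^-1 *: (f u - f 0)) _ _ (c^-1 *: (y - f 0)).
- by rewrite subrr scaler0.
- move=> u v; apply/eqP; rewrite -(@eqrXn2 _ 2) ?edist_ge0//; apply/eqP.
  apply: (mulfI (x := c ^+ 2)); first by rewrite expf_neq0// gt_eqF.
  rewrite -[RHS]exprMn -fc !sqr_edist mulr_sumr; apply: eq_bigr => i _.
  by rewrite !mxE; field; rewrite gt_eqF.
move=> /(scalerI (invr_neq0 (lt0r_neq0 c0)))/(congr1 (fun z => z + f 0)).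
by rewrite !subrK; exists u.
Qed.

(** The construction runs in a ball of radius [a0 / k] and its radius is divided by [k]. Counting at
    scale [k * rho] relative to [a0 / k] costs the factor [k^4]; in the error term the cost [k^s] is
    absorbed in [theta']. *)
Lemma ubiquitous_image (X : normedModType R) (f : X -> X) (k s : R) (V : nat -> set X) :
  1 <= k -> 0 < s -> (forall y, exists x, f x = y) ->
  (forall u v, `|f u - f v| <= k * `|u - v|) ->
  (forall u v, `|u - v| <= k * `|f u - f v|) ->
  ubiquitous s V -> ubiquitous s (fun n => f @` V n).
Proof.
move=> k1 s0 fsurj fle fge [C C0 ubi]; exists (C * k ^+ 4).
  by rewrite mulr_gt0// exprn_gt0// (lt_le_trans _ k1).
have k0 : 0 < k by apply: lt_le_trans k1.
have ks0 : 0 < k `^ s by rewrite powR_gt0.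
move=> a0 theta n0 a0_gt0 theta0.
pose theta' := Num.min theta (theta / k `^ s).
have theta'0 : 0 < theta' by rewrite lt_min theta0 divr_gt0.
have [n [a [M [n0n a_gt0 a_theta M0 H]]]] := ubi (a0 / k) theta' n0 (divr_gt0 a0_gt0 k0) theta'0.
move: (a_theta); rewrite le_min => /andP[ath _].
exists n, (a / k), M; split => //.
- by rewrite divr_gt0.
- by rewrite ler_pdivrMr// (le_trans ath)// ler_peMr// ltW.
move=> p; have [p' fp'] := fsurj p; have [cs [szcs csP cnt]] := H p'.
exists (map f cs); split; first by rewrite size_map.
  move=> _ /mapP[c ccs ->]; have [cp cV] := csP c ccs; split.
    have := fle c p'; rewrite fp' => h.
    have : k * (`|c - p'| + a) <= a0 by rewrite mulrC -ler_pdivlMr.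
    rewrite mulrDr => h2.
    have : a / k <= k * a.
      rewrite ler_pdivrMr// mulrAC ler_peMl ?(ltW a_gt0)//; nra.
    lra.
  move=> y yc; have [y' fy'] := fsurj y; exists y' => //; apply: cV.
  by rewrite (le_trans (fge _ _))// fy' mulrC -ler_pdivlMr.
move=> x rho arho; have [x' fx'] := fsurj x.
have rho0 : 0 < rho by apply: lt_le_trans arho; rewrite divr_gt0.
have akrho : a <= k * rho by rewrite mulrC -ler_pdivrMr.
apply: (@le_trans _ _ (count (fun c => `|c - x'| <= 2 * (k * rho)) cs)%:R).
  rewrite ler_nat count_map; apply: sub_count => c /= h.
  by rewrite (le_trans (fge _ _))// fx' mulrCA ler_wpM2l// ltW.
apply: (le_trans (cnt x' _ akrho)); rewrite ler_wpM2l//; apply: lerD.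
  rewrite le_eqVlt; apply/orP; left; apply/eqP; field.
  by rewrite !gt_eqF.
rewrite powRM ?(ltW k0) ?(ltW rho0)// mulrA ler_wpM2r ?powR_ge0//.
by rewrite -ler_pdivlMr// ge_min lexx orbT.
Qed.

Lemma ubiquitous_similarity (f : 'cV[R]_2 -> 'cV[R]_2) (s : R) (V : nat -> set 'cV[R]_2) :
  0 < s -> similarity f -> ubiquitous s V -> ubiquitous s (fun n => f @` V n).
Proof.
move=> s0 simf; have [c c0 fc] := simf.
(* Scaling by [c] or [c^-1], and a factor 2 between the Euclidean and the max norm. *)
apply: (ubiquitous_image (k := 1 + 2 * c + 2 / c)) => //.
- by have := divr_gt0 (@ltr0n R 2) c0; lra.
- exact: similarity_surj.
- move=> u v; apply: (le_trans (norm_le_edist _ _)); rewrite fc.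
  have h := edist_le_norm u v; have c2 : 0 < 2 / c by rewrite divr_gt0.
  have := normr_ge0 (u - v); set t := `|_| in h *; nra.
move=> u v; apply: (le_trans (norm_le_edist _ _)).
have -> : edist u v = edist (f u) (f v) / c by rewrite fc mulrC mulKf// gt_eqF.
have h := edist_le_norm (f u) (f v).
apply: (@le_trans _ _ ((2 / c) * `|f u - f v|)).
  by rewrite mulrAC ler_wpM2r// invr_ge0 ltW.
by rewrite ler_wpM2r//; lra.
Qed.

End Plane.

(** * Eigen-coordinates of a hyperbolic integer matrix *)

Section QuadraticUnit.

Lemma dvdz_sqr_coprime (m n k : int) : coprimez n m -> n * n = m * k -> `|m| = 1.
Proof.
move=> cop e; have mn : (m %| n * n)%Z by rewrite e dvdz_mulr.
rewrite Gauss_dvdzr 1?coprimez_sym// in mn.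
have : (m %| gcdz n m)%Z by rewrite dvdz_gcd mn dvdzz.
by rewrite (eqP cop) dvdz1 => /eqP h; rewrite -abszE h.
Qed.

(** Rational root theorem: [x / y] is a root of a monic integer polynomial with constant term [d],
    so its reduced numerator and denominator are both units. *)
Lemma ratio_unit_root (x y t d : int) : y != 0 -> `|d| = 1 ->
  x ^+ 2 - t * x * y + d * y ^+ 2 = 0 -> `|x| = `|y|.
Proof.
move=> y0 d1 e; pose r : rat := x%:~R / y%:~R.
have yq : (y%:~R : rat) != 0 by rewrite intr_eq0.
have xE : x%:~R = r * y%:~R by rewrite divfK.
have dd : d * d = 1 by rewrite -expr2 -real_normK ?num_real// d1.
have mq : ((denq r)%:~R : rat) != 0 by rewrite intr_eq0 denq_neq0.
have rE : r * (denq r)%:~R = (numq r)%:~R by rewrite -{1}(divq_num_den r) divfK.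
have re : r ^+ 2 - t%:~R * r + d%:~R = 0.
  apply: (mulIf (expf_neq0 2 yq)); rewrite mul0r.
  have /(congr1 (fun z : int => z%:~R : rat)) := e.
  rewrite !expr2 !(rmorphB, rmorphD, rmorphN, rmorphM) /= xE rmorph0 => <-.
  ring.
move: (coprime_num_den r) rE mq; rewrite -/(coprimez (numq r) (denq r)).
move: (numq r) (denq r) => n m cop rE mq.
have nm : n ^+ 2 - t * n * m + d * m ^+ 2 = 0.
  apply/eqP; rewrite -(intr_eq0 rat); apply/eqP.
  rewrite !expr2 !(rmorphB, rmorphD, rmorphN, rmorphM) /= -rE.
  by rewrite -[RHS](mulr0 (m%:~R ^+ 2)) -re; ring.
have m1 : `|m| = 1 by apply: (dvdz_sqr_coprime (k := t * n - d * m) cop); lia.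
have n1 : `|n| = 1.
  apply: (dvdz_sqr_coprime (n := m) (k := d * (t * m - n))); first by rewrite coprimez_sym.
  have : d * (n ^+ 2 - t * n * m + d * m ^+ 2) = 0 by rewrite nm mulr0.
  have -> : d * (n ^+ 2 - t * n * m + d * m ^+ 2) =
    (d * d) * (m * m) - n * (d * (t * m - n)) by ring.
  by rewrite dd mul1r => /eqP; rewrite subr_eq0 => /eqP.
have r1 : `|r| = 1.
  have := congr1 (fun z : rat => `|z|) rE; rewrite /= normrM -!intr_norm m1 n1 mulr1.
  by [].
apply/eqP; rewrite -(eqr_int rat) !intr_norm xE normrM r1 mul1r; exact/eqP.
Qed.

End QuadraticUnit.

Section Eigen.
Context {R : realType}.

Lemma det_mx22 (K : comPzRingType) (M : 'M[K]_2) : \det M = M 0 0 * M 1 1 - M 0 1 * M 1 0.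
Proof.
rewrite (expand_det_row _ 0) !big_ord_recl big_ord0 addr0 /cofactor !det_mx11 !mxE /=.
rewrite (_ : lift 0 0 = 1); last exact/val_inj.
rewrite (_ : lift 1 0 = 0); last exact/val_inj.
by rewrite expr0 mul1r expr1 mulN1r mulrN.
Qed.

Lemma ord2_cases (i : 'I_2) : i = 0 \/ i = 1.
Proof. by case: i => [[|[|//]] ?]; [left|right]; exact/val_inj. Qed.

(** A nonreal root would have squared modulus equal to the determinant, which is at most 1. *)
Lemma real_eigenvalue (A : 'M[int]_2) (lambda : R[i]) :
  `|\det A| = 1 -> eigenvalue (map_mx intr A : 'M[R[i]]_2) lambda -> 1 < `|lambda| ->
  exists l : R, [/\ `|l| = complex.Re `|lambda|, 1 < `|l| &
    l ^+ 2 - (A 0 0 + A 1 1)%:~R * l + (A 0 0 * A 1 1 - A 0 1 * A 1 0)%:~R = 0].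
Proof.
move=> Adet /eigenvalueP[v vA v0] l1.
have root : lambda ^+ 2 - (A 0 0 + A 1 1)%:~R * lambda +
    (A 0 0 * A 1 1 - A 0 1 * A 1 0)%:~R = 0.
  have e0 := congr1 (fun M : 'rV_2 => M 0 0) vA.
  have e1 := congr1 (fun M : 'rV_2 => M 0 1) vA.
  move: e0 e1; rewrite /= !mxE !big_ord_recl !big_ord0 !mxE.
  rewrite (_ : lift 0 0 = 1); last exact/val_inj.
  rewrite !addr0 rmorphD rmorphB /= !rmorphM /=.
  move: (A 0 0)%:~R (A 0 1)%:~R (A 1 0)%:~R (A 1 1)%:~R => a b c e e0 e1.
  have [v00|v00] := eqVneq (v 0 0) 0.
    have v01 : v 0 1 != 0.
      apply: contra v0 => /eqP v01; apply/eqP/rowP => i; rewrite mxE.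
      by have [->|->] := ord2_cases i.
    apply: (mulIf v01); rewrite mul0r.
    have -> : (lambda ^+ 2 - (a + e) * lambda + (a * e - b * c)) * v 0 1 =
      (lambda - a) * (lambda * v 0 1) - (lambda - a) * e * v 0 1 - b * (c * v 0 1) by ring.
    have -> : c * v 0 1 = lambda * v 0 0 - v 0 0 * a by rewrite -e0; ring.
    by rewrite -e1; ring.
  apply: (mulIf v00); rewrite mul0r.
  have -> : (lambda ^+ 2 - (a + e) * lambda + (a * e - b * c)) * v 0 0 =
    (lambda - e) * (lambda * v 0 0) - (lambda - e) * a * v 0 0 - c * (b * v 0 0) by ring.
  have -> : b * v 0 0 = lambda * v 0 1 - v 0 1 * e by rewrite -e1; ring.
  by rewrite -e0; ring.
rewrite det_mx22 in Adet.
move: l1 root; rewrite normc_def ltcE /=.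
move: (A 0 0 + A 1 1) (A 0 0 * A 1 1 - A 0 1 * A 1 0) Adet => t d d1.
case: lambda {vA} => x y /= /andP[_ l1].
have xy1 : 1 < x ^+ 2 + y ^+ 2.
  by rewrite -(sqr_sqrtr (addr_ge0 (sqr_ge0 x) (sqr_ge0 y))) exprn_egt1.
rewrite -[t%:~R](rmorph_int (real_complex R)) -[d%:~R](rmorph_int (real_complex R)).
have -> : (x +i* y)%C ^+ 2 - (t%:~R)%:C%C * (x +i* y)%C + (d%:~R)%:C%C =
    ((x ^+ 2 - y ^+ 2 - t%:~R * x + d%:~R) +i* (2 * x * y - t%:~R * y))%C :> R[i].
  by rewrite expr2; apply/eqP; rewrite eq_complex /=; apply/andP; split; apply/eqP; ring.
move=> /eqP; rewrite eq_complex /= => /andP[/eqP e0 /eqP e1].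
have d_le1 : (d%:~R : R) <= 1.
  by rewrite (le_trans (ler_norm _))// -intr_norm d1.
have y0 : y = 0.
  have : y * (2 * x - t%:~R) = 0 by lra.
  move=> /eqP; rewrite mulf_eq0 => /orP[/eqP//|/eqP tx].
  exfalso; have tE : t%:~R = 2 * x by lra.
  clear l1 d1 e1 tx; rewrite tE in e0; clear tE.
  move: (d%:~R) e0 d_le1 => D e0 D1; nra.
exists x; rewrite y0 expr0n addr0 sqrtr_sqr; split => //.
  by move: l1; rewrite y0 expr0n addr0 sqrtr_sqr.
by rewrite y0 expr0n subr0 in e0.
Qed.

End Eigen.

Section Frame.
Context {R : realType}.

(** [mu] is the other eigenvalue, [mk] builds a vector from its coordinates and [B] serves in all
    norm comparisons. [frame_int] is the arithmetic input. *)
Record hyperbolic_frame (A : 'M[int]_2) (l mu : R) (xi eta : 'cV[R]_2 -> R)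
    (mk : R -> R -> 'cV[R]_2) (B : R) : Prop := HyperbolicFrame {
  frame_l : 1 < `|l|;
  frame_lmu : `|l * mu| = 1;
  frame_B : 1 <= B;
  frame_xiD : {morph xi : u v / u + v};
  frame_etaD : {morph eta : u v / u + v};
  frame_xi_mk : forall x y, xi (mk x y) = x;
  frame_eta_mk : forall x y, eta (mk x y) = y;
  frame_xi_le : forall u, `|xi u| <= B * `|u|;
  frame_eta_le : forall u, `|eta u| <= B * `|u|;
  frame_le : forall u, `|u| <= B * (`|xi u| + `|eta u|);
  frame_xiA : forall u, xi (map_mx intr A *m u) = l * xi u;
  frame_etaA : forall u, eta (map_mx intr A *m u) = mu * eta u;
  frame_int : forall z, z \is a mxOver Num.int -> z != 0 -> 1 <= `|xi z * eta z| }.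

(** The row [(A 1 0, l - A 0 0)], a left eigenvector of [A] for [l], seen as a linear form. *)
Definition eigf (A : 'M[int]_2) (l : R) (u : 'cV[R]_2) : R :=
  (A 1 0)%:~R * u 0 0 + (l - (A 0 0)%:~R) * u 1 0.

Definition charf (A : 'M[int]_2) (l : R) : R :=
  l ^+ 2 - (A 0 0 + A 1 1)%:~R * l + (A 0 0 * A 1 1 - A 0 1 * A 1 0)%:~R.

Lemma eigf_mul A l u : charf A l = 0 -> eigf A l (map_mx intr A *m u) = l * eigf A l u.
Proof.
rewrite /charf /eigf !mxE !big_ord_recl !big_ord0 !mxE.
rewrite (_ : lift 0 0 = 1) ?addr0; last exact/val_inj.
rewrite !(rmorphB, rmorphD, rmorphN, rmorphM) /=.
move: (A 0 0)%:~R (A 0 1)%:~R (A 1 0)%:~R (A 1 1)%:~R => a b c e h.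
apply/eqP; rewrite -subr_eq0; apply/eqP.
rewrite (_ : ord0 = 0 :> 'I_2); last exact/val_inj.
rewrite -[RHS](mulr0 (- u 1 0)) -h; ring.
Qed.

(** A nonzero integer zero of the form would make [l] rational, and a rational root of the
    characteristic polynomial is 1 or -1. *)
Lemma eigf_int_eq0 A l z : `|\det A| = 1 -> A 1 0 != 0 -> charf A l = 0 -> `|l| != 1 ->
  z \is a mxOver Num.int -> eigf A l z = 0 -> z = 0.
Proof.
move=> Adet c0 lA l1 /mxOverP zint ez.
have /intrP[x xE] := zint 0 0; have /intrP[y yE] := zint 1 0.
move: ez; rewrite /eigf xE yE => ez.
have cR : ((A 1 0)%:~R : R) != 0 by rewrite intr_eq0.
have [y0|y0] := eqVneq y 0.
  move: ez; rewrite y0 mulr0 addr0 => /eqP; rewrite mulf_eq0 (negPf cR)/= => /eqP x0.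
  by apply/colP => i; rewrite mxE; have [->|->] := ord2_cases i; rewrite ?xE ?yE ?y0.
exfalso; move/negP: l1; apply.
have yR : (y%:~R : R) != 0 by rewrite intr_eq0.
have ly : l * y%:~R = (A 0 0 * y - A 1 0 * x)%:~R.
  by rewrite !(rmorphB, rmorphM)/=; lra.
have : `|A 0 0 * y - A 1 0 * x| = `|y|.
  apply: (ratio_unit_root (t := A 0 0 + A 1 1) (d := A 0 0 * A 1 1 - A 0 1 * A 1 0)) => //.
    by rewrite -det_mx22.
  apply/eqP; rewrite -(intr_eq0 R); apply/eqP.
  move: (A 0 0 * y - _) ly => p ly.
  rewrite !expr2 !(rmorphB, rmorphD, rmorphN, rmorphM) /= -ly.
  rewrite -[RHS](mulr0 (y%:~R ^+ 2)) -lA /charf !(rmorphB, rmorphD, rmorphN, rmorphM) /=.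
  by ring.
move=> /(congr1 (fun z : int => z%:~R : R)); rewrite !intr_norm -ly normrM => h.
by apply/eqP; apply: (mulIf (x := `|y%:~R|)); rewrite ?normr_eq0// mul1r.
Qed.

(** For [frame_int], the product of the two forms is symmetric in [l] and [mu], hence [A 1 0] times
    an integral binary quadratic form; it vanishes only at 0 because neither eigenvalue is
    rational. *)
Lemma hyperbolic_frame_exists (A : 'M[int]_2) (l : R) : `|\det A| = 1 -> 1 < `|l| ->
  charf A l = 0 -> exists mu xi eta mk B, hyperbolic_frame A l mu xi eta mk B.
Proof.
move=> Adet l1 lA.
pose t : R := (A 0 0 + A 1 1)%:~R.
pose d : R := (A 0 0 * A 1 1 - A 0 1 * A 1 0)%:~R.
have d1 : `|d| = 1 by rewrite /d -det_mx22 -intr_norm Adet.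
have [mu [mut lmu]] : exists mu, mu = t - l /\ l * mu = d.
  by exists (t - l); split => //; move: lA; rewrite /charf -/t -/d; lra.
have muA : charf A mu = 0 by move: lA; rewrite /charf -/t -/d mut; lra.
have lmu1 : `|l * mu| = 1 by rewrite lmu.
have mu1 : `|mu| < 1.
  by move: lmu1; rewrite normrM; have := normr_ge0 mu; nra.
have lNmu : l - mu != 0.
  by rewrite subr_eq0; apply: contraTneq l1 => ->; rewrite -leNgt ltW.
(* Otherwise the eigenvalues are the diagonal entries, which are units of the integers. *)
have c0 : A 1 0 != 0.
  apply: contraTneq l1 => c0; rewrite -leNgt.
  have ae : `|A 0 0 * A 1 1| = 1 by move: Adet; rewrite det_mx22 c0 mulr0 subr0.
  have [a1 e1] : `|A 0 0| = 1 /\ `|A 1 1| = 1.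
    have /eqP : muln (absz (A 0 0)) (absz (A 1 1)) = 1%N.
      by rewrite -abszM; apply/eqP; rewrite -eqz_nat abszE ae.
    by rewrite muln_eq1 -!abszE => /andP[/eqP -> /eqP ->].
  have : (l - (A 0 0)%:~R) * (l - (A 1 1)%:~R) = 0.
    move: lA; rewrite /charf c0 !(rmorphB, rmorphD, rmorphN, rmorphM)/= => <-.
    by rewrite mulr0z; ring.
  by move=> /eqP; rewrite mulf_eq0 !subr_eq0 => /orP[]/eqP->; rewrite -intr_norm ?a1 ?e1.
pose a : R := (A 0 0)%:~R; pose c : R := (A 1 0)%:~R.
have cR : c != 0 by rewrite intr_eq0.
pose mk x y : 'cV[R]_2 := \col_i if i == 0 then (x - (l - a) * ((x - y) / (l - mu))) / c
  else (x - y) / (l - mu).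
have xi_mk x y : eigf A l (mk x y) = x.
  by rewrite /eigf !mxE /= -/c -/a; field; rewrite ?cR ?lNmu.
have eta_mk x y : eigf A mu (mk x y) = y.
  by rewrite /eigf !mxE /= -/c -/a; field; rewrite ?cR ?lNmu.
have eigf_le k u : `|eigf A k u| <= (`|c| + `|k - a|) * `|u|.
  rewrite /eigf -/c -/a (le_trans (ler_normD _ _))// !normrM mulrDl.
  by rewrite lerD// ler_wpM2l// cV_coord_le.
have u1E (u : 'cV[R]_2) : u 1 0 = (eigf A l u - eigf A mu u) / (l - mu).
  by rewrite /eigf; field.
have u0E (u : 'cV[R]_2) : u 0 0 = (eigf A l u - (l - a) * u 1 0) / c.
  by rewrite /eigf -/a -/c; field.
pose K := `|l - mu|^-1; pose K' := `|c|^-1 * (1 + `|l - a| * K).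
have K0 : 0 <= K by rewrite invr_ge0.
have K'0 : 0 <= K' by rewrite mulr_ge0 ?invr_ge0// addr_ge0// mulr_ge0.
have u1_le (u : 'cV[R]_2) : `|u 1 0| <= K * (`|eigf A l u| + `|eigf A mu u|).
  by rewrite u1E normrM normfV mulrC ler_wpM2l// ler_normB.
have u0_le (u : 'cV[R]_2) : `|u 0 0| <= K' * (`|eigf A l u| + `|eigf A mu u|).
  rewrite u0E normrM normfV mulrC /K' -mulrA ler_wpM2l ?invr_ge0//.
  rewrite (le_trans (ler_normB _ _))// normrM mulrDl mul1r -mulrA.
  by rewrite lerD ?ler_wpM2l// lerDl.
exists mu, (eigf A l), (eigf A mu), mk,
  (1 + (`|c| + `|l - a|) + (`|c| + `|mu - a|) + K + K').
set B := 1 + _ + _ + _ + _.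
have cl0 : 0 <= `|c| + `|l - a| by rewrite addr_ge0.
have cm0 : 0 <= `|c| + `|mu - a| by rewrite addr_ge0.
split => //.
- by rewrite /B; lra.
- by move=> u v; rewrite /eigf !mxE; ring.
- by move=> u v; rewrite /eigf !mxE; ring.
- by move=> u; rewrite (le_trans (eigf_le _ _))// ler_wpM2r// /B; lra.
- by move=> u; rewrite (le_trans (eigf_le _ _))// ler_wpM2r// /B; lra.
- move=> u; have S0 : 0 <= `|eigf A l u| + `|eigf A mu u| by rewrite addr_ge0.
  apply/cV_norm_le => [|i]; first by rewrite mulr_ge0// /B; lra.
  have [->|->] := ord2_cases i; [apply: (le_trans (u0_le _))|apply: (le_trans (u1_le _))];
    rewrite ler_wpM2r// /B; lra.
- by move=> u; exact: eigf_mul.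
- by move=> u; exact: eigf_mul.
move=> z zint z0.
have lN1 : `|l| != 1 by rewrite gt_eqF.
have muN1 : `|mu| != 1 by rewrite lt_eqF.
have xi0 : eigf A l z != 0.
  by apply: contra_neq z0; exact: eigf_int_eq0.
have eta0 : eigf A mu z != 0.
  by apply: contra_neq z0; exact: eigf_int_eq0.
have : eigf A l z * eigf A mu z \is a Num.int.
  have /mxOverP zi := zint; have := zi 0 0; have := zi 1 0.
  move=> /intrP[y yE] /intrP[x xE].
  rewrite (_ : _ * _ = (A 1 0 * (A 1 0 * x ^+ 2 + (A 1 1 - A 0 0) * x * y - A 0 1 * y ^+ 2))%:~R).
    by rewrite intr_int.
  rewrite /eigf xE yE !expr2 !(rmorphB, rmorphD, rmorphN, rmorphM) /= -/a -/c.
  have h : l * mu = a * (A 1 1)%:~R - (A 0 1)%:~R * c.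
    by rewrite lmu /d !(rmorphB, rmorphM).
  have ht : mu = a + (A 1 1)%:~R - l by rewrite mut /t rmorphD.
  move: h; rewrite ht; move: (A 1 1)%:~R (A 0 1)%:~R (x%:~R) (y%:~R) => e b X Y h.
  apply/eqP; rewrite -subr_eq0; apply/eqP.
  rewrite -[RHS](mulr0 (Y * Y)) -(subrr (a * e - b * c)) -{1}h; ring.
by move=> h; apply: norm_intr_ge1; rewrite // mulf_neq0.
Qed.

End Frame.

(** * Ubiquity of the return sets *)

Section Counting.
Context {R : realType}.

Lemma int_vecB n (u v : 'cV[R]_n) : u \is a mxOver Num.int -> v \is a mxOver Num.int ->
  u - v \is a mxOver Num.int.
Proof. by move=> /mxOverP ui /mxOverP vi; apply/mxOverP => i j; rewrite !mxE rpredB. Qed.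

Lemma card_le_mul (T : finType) (P : pred T) (f g : T -> nat) (K1 K2 : nat) :
  (forall x, P x -> (f x < K1)%N /\ (g x < K2)%N) ->
  (forall x y, P x -> P y -> f x = f y -> g x = g y -> x = y) ->
  (#|P| <= K1 * K2)%N.
Proof.
case: (pickP P) => [x0 Px0|P0 _ _]; last by rewrite eq_card0.
move=> bnd inj; have [f0 g0] := bnd x0 Px0.
case: K1 K2 f0 g0 bnd => [|K1] [|K2] // _ _ bnd.
pose h x : 'I_K1.+1 * 'I_K2.+1 := (inord (f x), inord (g x)).
have <- : #|h @: P| = #|P|.
  apply: card_in_imset => x y Px Py [/(congr1 val) /= fxy /(congr1 val) /= gxy].
  have [fx gx] := bnd x Px; have [fy gy] := bnd y Py.
  by rewrite !inordK // in fxy gxy; exact: inj.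
by apply: leq_trans (max_card _) _; rewrite card_prod !card_ord.
Qed.

Context {A : 'M[int]_2} {l mu : R} {xi eta : 'cV[R]_2 -> R} {mk : R -> R -> 'cV[R]_2} {B : R}.
Hypothesis F : hyperbolic_frame A l mu xi eta mk B.

Lemma frame_xiB : {morph xi : u v / u - v}.
Proof.
move=> u v; have xi0 : xi 0 = 0 by apply: (addIr (xi 0)); rewrite -(frame_xiD F) !addr0 add0r.
by rewrite (frame_xiD F); congr (_ + _); apply: (addIr (xi v)); rewrite -(frame_xiD F) !addNr xi0.
Qed.

Lemma frame_etaB : {morph eta : u v / u - v}.
Proof.
move=> u v; have eta0 : eta 0 = 0 by apply: (addIr (eta 0)); rewrite -(frame_etaD F) !addr0 add0r.
by rewrite (frame_etaD F); congr (_ + _); apply: (addIr (eta v)); rewrite -(frame_etaD F) !addNr eta0.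
Qed.

(** Slabs of width [1 / (4 * Y)] in the direction of [xi]: two points of one slab whose [eta] differ
    by at most [2 * Y] have a difference of norm form below 1/2. The shift by [X] keeps the argument
    of [truncn] nonnegative on the box. *)
Definition cell (x0 X Y : R) (z : 'cV[R]_2) : nat := Num.truncn ((xi z - x0 + X) * (4 * Y)).

Lemma truncn_eq_dist (x y : R) : 0 <= x -> 0 <= y -> Num.truncn x = Num.truncn y -> `|x - y| < 1.
Proof.
move=> /truncn_itv/andP[x1 x2] /truncn_itv/andP[y1 y2] e.
rewrite e in x1 x2; rewrite -natr1 in x2; rewrite -natr1 in y2.
by rewrite ltr_norml; apply/andP; split; lra.
Qed.

(* The points of an integer lattice in a box lie in different cells, because
   the norm form [xi * eta] is at least 1 in absolute value on nonzero integer vectors. *)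
Lemma cell_inj (x0 y0 X Y : R) (z z' : 'cV[R]_2) : 0 < Y ->
  z \is a mxOver Num.int -> z' \is a mxOver Num.int ->
  `|xi z - x0| <= X -> `|eta z - y0| <= Y ->
  `|xi z' - x0| <= X -> `|eta z' - y0| <= Y ->
  cell x0 X Y z = cell x0 X Y z' -> z = z'.
Proof.
move=> Y0 zi z'i xz yz xz' yz' e.
apply/eqP; rewrite -subr_eq0; apply/negPn/negP => nz.
have zz : z - z' \is a mxOver Num.int by exact: int_vecB.
have := frame_int F zz nz; apply/negP; rewrite -ltNge.
have pos w : `|xi w - x0| <= X -> 0 <= (xi w - x0 + X) * (4 * Y).
  by rewrite ler_norml => /andP[h _]; rewrite mulr_ge0 ?mulr_ge0 ?(ltW Y0)//; lra.
have := truncn_eq_dist (pos _ xz) (pos _ xz') e.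
rewrite -mulrBl normrM (ger0_norm (x := 4 * Y)) ?mulr_ge0 ?(ltW Y0)//.
rewrite (_ : xi z - x0 + X - _ = xi z - xi z'); last by ring.
move=> h; rewrite normrM frame_xiB frame_etaB.
have : `|eta z - eta z'| <= 2 * Y.
  by have := ler_distD y0 (eta z) (eta z'); rewrite (distrC y0); lra.
have := normr_ge0 (xi z - xi z'); have := normr_ge0 (eta z - eta z').
nra.
Qed.

Lemma cell_lt (x0 X Y : R) (z : 'cV[R]_2) : 0 < Y -> `|xi z - x0| <= X ->
  (cell x0 X Y z < (Num.truncn (8 * X * Y)).+1)%N.
Proof.
move=> Y0 xz; rewrite ltnS; apply: le_truncn.
rewrite [leRHS](_ : _ = (2 * X) * (4 * Y)); last by ring.
rewrite ler_wpM2r ?mulr_ge0 ?(ltW Y0)//.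
by move: xz; rewrite ler_norml => /andP[_]; lra.
Qed.

Lemma truncnS_le (x : R) : 0 <= x -> (Num.truncn x).+1%:R <= x + 1.
Proof. by move=> /truncn_itv/andP[h _]; rewrite -natr1 lerD2r. Qed.

(** Each integer vector [z i] carries a row of [len] centres with step [a] in the direction of
    [eta]. At most [W] rows come near [x], by the cell count. The two bounds count in each such row
    all its centres, or only those within reach. *)
Lemma count_centers (I : finType) (z : I -> 'cV[R]_2) (q a b rho : R) (len : nat) (x : 'cV[R]_2) :
  injective z -> (forall i, z i \is a mxOver Num.int) ->
  0 < q -> 0 < a -> a <= rho -> 0 < b -> len%:R * a <= b ->
  let P := [pred ij : I * 'I_len |
    `|mk (xi (z ij.1) / q) (- eta (z ij.1) / q + ij.2%:R * a) - x| <= 2 * rho] in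
  let W := 16 * B * q ^+ 2 * rho * (2 * B * rho + b) + 1 in
  #|P|%:R <= W * len%:R /\ #|P|%:R <= W * (4 * B * rho / a + 1).
Proof.
move=> zinj zint q0 a0 arho b0 lenb P W.
have rho0 : 0 < rho by apply: lt_le_trans arho.
have B1 := frame_B F; have B0 : 0 < B by apply: lt_le_trans B1.
pose X := 2 * B * q * rho; pose Y := 2 * B * q * rho + q * b.
have X0 : 0 <= X by rewrite !mulr_ge0// ltW.
have Y0 : 0 < Y by rewrite addr_gt0 ?mulr_gt0.
have WE : W = 8 * X * Y + 1 by rewrite /W /X /Y; ring.
have XY0 : 0 <= 8 * X * Y by rewrite !mulr_ge0// ltW.
pose c (ij : I * 'I_len) := cell (q * xi x) X Y (z ij.1).
pose g (ij : I * 'I_len) := - eta (z ij.1) / q + ij.2%:R * a - eta x.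
have Px ij : P ij -> `|xi (z ij.1) - q * xi x| <= X.
  move=> /= h; have := frame_xi_le F (mk (xi (z ij.1) / q) (- eta (z ij.1) / q + ij.2%:R * a) - x).
  rewrite frame_xiB (frame_xi_mk F) => h'.
  rewrite (_ : xi (z ij.1) - q * xi x = q * (xi (z ij.1) / q - xi x)); last by field; rewrite gt_eqF.
  rewrite normrM gtr0_norm// /X -[leRHS]mulrA [leRHS](_ : _ = q * (B * (2 * rho))); last by ring.
  by rewrite ler_wpM2l ?(ltW q0)// (le_trans h')// ler_wpM2l// ltW.
have Pg ij : P ij -> `|g ij| <= 2 * B * rho.
  move=> /= h; have := frame_eta_le F (mk (xi (z ij.1) / q) (- eta (z ij.1) / q + ij.2%:R * a) - x).
  rewrite frame_etaB (frame_eta_mk F) => h'; apply: (le_trans h').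
  by rewrite (mulrC 2) -mulrA ler_wpM2l// ltW.
have Py ij : P ij -> `|eta (z ij.1) - (- q * eta x)| <= Y.
  move=> /Pg h.
  rewrite (_ : eta (z ij.1) - _ = q * (ij.2%:R * a - g ij)); last by rewrite /g; field; rewrite gt_eqF.
  rewrite normrM gtr0_norm// /Y [leRHS](_ : _ = q * (b + 2 * B * rho)); last by ring.
  rewrite ler_wpM2l ?(ltW q0)// (le_trans (ler_normB _ _))// lerD//.
  rewrite ger0_norm ?mulr_ge0 ?(ltW a0)// (le_trans _ lenb)// ler_wpM2r ?(ltW a0)//.
  by rewrite ler_nat ltnW.
have cinj ij ij' : P ij -> P ij' -> c ij = c ij' -> ij.1 = ij'.1.
  move=> p p' e; apply: zinj.
  exact: (cell_inj Y0 (zint _) (zint _) (Px _ p) (Py _ p) (Px _ p') (Py _ p') e).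
have clt ij : P ij -> (c ij < (Num.truncn (8 * X * Y)).+1)%N.
  by move=> p; apply: cell_lt => //; exact: Px.
split.
  apply: (@le_trans _ _ ((Num.truncn (8 * X * Y)).+1 * len)%:R).
    rewrite ler_nat; apply: (card_le_mul (f := c) (g := fun ij => ij.2 : nat)).
      by move=> ij p; split => //; exact: clt.
    by move=> [i j] [i' j'] p p' /(cinj _ _ p p') /= -> /val_inj ->.
  by rewrite natrM WE ler_wpM2r// truncnS_le.
pose G := 4 * B * rho / a.
have G0 : 0 <= G by rewrite divr_ge0 ?mulr_ge0// ltW.
pose gt ij := Num.truncn ((g ij + 2 * B * rho) / a).
have gpos ij : P ij -> 0 <= (g ij + 2 * B * rho) / a.
  by move=> /Pg; rewrite ler_norml => /andP[h _]; rewrite divr_ge0 ?(ltW a0)//; lra.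
apply: (@le_trans _ _ ((Num.truncn (8 * X * Y)).+1 * (Num.truncn G).+1)%:R).
  rewrite ler_nat; apply: (card_le_mul (f := c) (g := gt)).
    move=> ij p; split; first exact: clt.
    rewrite ltnS; apply: le_truncn; rewrite /G ler_wpM2r ?invr_ge0 ?(ltW a0)//.
    by move: (Pg _ p); rewrite ler_norml => /andP[_]; lra.
  move=> [i j] [i' j'] p p' /(cinj _ _ p p') /= ii' /(truncn_eq_dist (gpos _ p) (gpos _ p')).
  rewrite -mulrBl (_ : g _ + _ - _ = (j%:R - j'%:R) * a); last by rewrite /g /= ii'; ring.
  rewrite mulfK ?gt_eqF// => jj'; rewrite ii'; congr (_, _); apply: val_inj => /=.
  apply/eqP; rewrite -(eqr_nat R); apply/negPn/negP => nj.
  have : 1 <= `|(j%:R - j'%:R : R)|.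
    by apply: norm_intr_ge1; rewrite ?subr_eq0// rpredB// natr_int.
  by rewrite leNgt jj'.
rewrite natrM WE; apply: ler_pM => //; rewrite ?ler0n// truncnS_le//.
Qed.

End Counting.

(** * Choice of the scales *)

Section Asymptotics.
Context {R : realType}.

Lemma expR_eventually_ge (c D : R) : 0 < c ->
  exists i0, forall i : nat, (i0 <= i)%N -> D <= expR (c * i%:R).
Proof.
move=> c0; exists (Num.truncn (D / c)).+1 => i hi.
apply: le_trans (expR_ge1Dx _).
have : D <= c * (Num.truncn (D / c)).+1%:R.
  rewrite mulrC -ler_pdivrMr//.
  have [h|h] := leP 0 (D / c); first by have /andP[_ /ltW] := truncn_itv h.
  by rewrite (le_trans (ltW h)).
have : c * (Num.truncn (D / c)).+1%:R <= c * i%:R by rewrite ler_wpM2l ?(ltW c0)// ler_nat.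
lra.
Qed.

Lemma exp_eventually (c D k : R) : 0 < c -> 0 < k ->
  exists i0, forall i : nat, (i0 <= i)%N -> D <= k * expR (c * i%:R).
Proof.
move=> c0 k0; have [i0 h] := expR_eventually_ge (D / k) c0.
by exists i0 => i /h; rewrite ler_pdivrMr// mulrC.
Qed.

(* The scales of the construction at time [n = 4 i]: [lam = |lambda|^(n/2)], the
   lattice of periodic points has mesh [1/q], and the ellipses of points
   returning at time [n] have semi-axes comparable to [a] and [b]. *)
Lemma scales_eventually (alpha L k1 k2 s D : R) :
  0 < alpha -> 0 < L -> 0 < k1 -> 0 < k2 -> 0 < s -> 0 < D ->
  s < 2 * L / (alpha + L) -> s < L / alpha ->
  exists i0, forall i : nat, (i0 <= i)%N ->
  let lam := expR (2 * L * i%:R) in let q := lam - lam^-1 in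
  let e := expR (- (4 * alpha * i%:R)) in let b := k1 * e in let a := k2 * e * lam ^- 2 in
  [/\ lam <= 2 * q, D <= q, D * b <= 1, D * a <= 1 &
    D <= q ^+ 2 * b `^ s /\ D * a `^ (1 - s) <= q ^+ 2 * b].
Proof.
move=> alpha0 L0 k10 k20 s0 D0 s1 s2.
(* [c1] and the number bounded in [c2] are the growth rates in [i] of [q^2 * b^s] and of
   [q^2 * b * a^(s - 1)]; each bound on [s] makes one of them positive. *)
have c1 : 0 < 4 * L - 4 * alpha * s by move: s2; rewrite ltr_pdivlMr//; lra.
have aL : 0 < alpha + L by rewrite addr_gt0.
have c2 : 0 < 8 * L - 4 * (alpha + L) * s by move: s1; rewrite ltr_pdivlMr//; lra.
have L2 : 0 < 2 * L by rewrite mulr_gt0.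
have a4 : 0 < 4 * alpha by rewrite mulr_gt0.
have aL4 : 0 < 4 * alpha + 4 * L by rewrite addr_gt0// mulr_gt0.
have K1 : 0 < k1 `^ s / 4 by rewrite divr_gt0// powR_gt0.
have K2 : 0 < k1 / k2 `^ (1 - s) / 4 by rewrite !divr_gt0// powR_gt0.
have [i1 h1] := exp_eventually (2 + 2 * D) L2 (@ltr01 R).
have [i2 h2] := exp_eventually D a4 (k := k1^-1) (ltac:(by rewrite invr_gt0)).
have [i3 h3] := exp_eventually D aL4 (k := k2^-1) (ltac:(by rewrite invr_gt0)).
have [i4 h4] := exp_eventually D c1 K1.
have [i5 h5] := exp_eventually D c2 K2.
exists (maxn i1 (maxn i2 (maxn i3 (maxn i4 i5)))) => i.
rewrite !geq_max => /andP[/h1 H1 /andP[/h2 H2 /andP[/h3 H3 /andP[/h4 H4 /h5 H5]]]].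
move=> lam q e b a; rewrite mul1r -/lam in H1.
have lam0 : 0 < lam by apply: expR_gt0.
have e0 : 0 < e by apply: expR_gt0.
have lamV : lam^-1 <= 1 by rewrite invf_le1//; lra.
have lamq : lam <= 2 * q by rewrite /q; lra.
have Dq : D <= q by rewrite /q; lra.
have q0 : 0 < q by apply: lt_le_trans Dq.
have b0 : 0 < b by rewrite mulr_gt0.
have a0 : 0 < a by rewrite mulr_gt0 ?mulr_gt0// invr_gt0 exprn_gt0.
have lam2 : lam ^+ 2 = expR (4 * L * i%:R) by rewrite -expRM_natl; congr expR; ring.
have aE : a = k2 * expR (- ((4 * alpha + 4 * L) * i%:R)).
  by rewrite /a lam2 -expRN -mulrA -expRD; congr (_ * expR _); ring.
have q2 : lam ^+ 2 / 4 <= q ^+ 2.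
  by rewrite ler_pdivrMr//; nra.
have powE (k x t : R) : 0 < k -> (k * expR x) `^ t = k `^ t * expR (x * t).
  by move=> k0; rewrite powRM ?(ltW k0) ?expR_ge0// expRM.
split => //.
- move: H2; rewrite ler_pdivlMl// => H2.
  by rewrite /b mulrA (mulrC D) /e expRN ler_pdivrMr ?expR_gt0// mul1r.
- move: H3; rewrite ler_pdivlMl// => H3.
  by rewrite aE mulrA (mulrC D) expRN ler_pdivrMr ?expR_gt0// mul1r.
split.
- apply: (le_trans H4).
  apply: (@le_trans _ _ (lam ^+ 2 / 4 * b `^ s)); last by rewrite ler_wpM2r ?powR_ge0.
  rewrite /b powE// lam2 le_eqVlt; apply/orP; left; apply/eqP.
  rewrite (_ : (4 * L - 4 * alpha * s) * i%:R = 4 * L * i%:R + - (4 * alpha * i%:R) * s); last by ring.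
  by rewrite expRD; field.
apply: (@le_trans _ _ (lam ^+ 2 / 4 * b)); last by rewrite ler_wpM2r// ltW.
rewrite aE powE// mulrA -ler_pdivlMr ?expR_gt0// mulrC -ler_pdivlMl ?powR_gt0//.
apply: (le_trans H5); rewrite le_eqVlt; apply/orP; left; apply/eqP.
rewrite lam2 /b /e -expRN.
rewrite (_ : (8 * L - 4 * (alpha + L) * s) * i%:R = 4 * L * i%:R + (- (4 * alpha * i%:R) +
  - (- ((4 * alpha + 4 * L) * i%:R) * (1 - s)))); last by ring.
by rewrite !expRD; field; rewrite gt_eqF// powR_gt0.
Qed.

End Asymptotics.

Ltac nonneg := lazymatch goal with
  | |- is_true (0 <= _%:R) => exact: ler0n
  | |- is_true (0 <= _ ^+ 2) => exact: sqr_ge0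
  | |- is_true (0 <= _ `^ _) => exact: powR_ge0
  | |- is_true (0 <= _ + _) => apply: addr_ge0; nonneg
  | |- is_true (0 <= _ * _) => apply: mulr_ge0; nonneg
  | |- is_true (0 <= _^-1) => rewrite invr_ge0; nonneg
  | |- _ => first [done | exact: ltW]
  end.

Section ReturnSets.
Context {R : realType}.

(** Applied to the exponent [1 - s], whose sign varies: adding both end values avoids a case
    distinction. *)
Lemma powR_between (a b x t : R) : 0 < a -> a <= x -> x <= b -> x `^ t <= a `^ t + b `^ t.
Proof.
move=> a0 ax xb; have x0 : 0 < x by apply: lt_le_trans ax.
have [t0|t0] := leP 0 t.
  rewrite (le_trans (ge0_ler_powR t0 _ _ xb)) ?nnegrE ?(ltW x0) ?(le_trans (ltW x0))//.
  by rewrite lerDr powR_ge0.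
have inv z : z `^ t = (z `^ (- t))^-1 by rewrite -powRN opprK.
apply: (@le_trans _ _ (a `^ t)); last by rewrite lerDl powR_ge0.
rewrite (inv x) (inv a) lef_pV2 ?posrE ?powR_gt0//.
by apply: ge0_ler_powR => //; rewrite ?nnegrE ?(ltW a0) ?(ltW x0)// oppr_ge0 ltW.
Qed.

Lemma count_enum (T : finType) (P : pred T) : count P (enum T) = #|P|.
Proof. by rewrite -sum1_count big_enum_cond /= -sum1_card. Qed.

(** The summand of [W] growing with [rho] yields the term in [(rho / a0)^2], the summand 1 yields
    the error term. For [rho >= b] whole rows are counted and the hypothesis on [b^s] absorbs the 1.
    For [rho < b] only a fraction of about [rho / b] of each row counts, and both hypotheses on [D]
    are needed. The constant is the sum of those of the two regimes. *)
Lemma count_numerics (B cc a0 q a b rho theta s D : R) (len n1 N : R) :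
  1 <= B -> 0 < cc -> 0 < a0 -> 0 < q -> 0 < a -> a <= rho -> 0 < b -> 0 < theta -> 0 < s ->
  0 < D -> 0 <= len -> b <= 2 * (len * a) -> cc * a0 * q <= 2 * n1 ->
  D <= q ^+ 2 * b `^ s -> D * a `^ (1 - s) <= q ^+ 2 * b ->
  80 * B <= D * (cc ^+ 2 * a0 ^+ 2 * theta) ->
  let W := 16 * B * q ^+ 2 * rho * (2 * B * rho + b) + 1 in
  N <= W * len -> N <= W * (4 * B * rho / a + 1) ->
  N <= n1 ^+ 2 * len *
    ((64 * B * (2 * B + 1) + 640 * B ^+ 2 * (2 * B + 1)) / cc ^+ 2 * (rho / a0) ^+ 2 +
     theta * rho `^ s).
Proof.
move=> B1 cc0 a00 q0 a_gt0 arho b0 th0 s0 D0 len0 blen n1q D1 D2 hD W N1 N2.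
have rho0 : 0 < rho by apply: lt_le_trans arho.
have B0 : 0 < B by apply: lt_le_trans B1.
pose Q := n1 ^+ 2.
have hQ : cc ^+ 2 * a0 ^+ 2 * q ^+ 2 <= 4 * Q.
  have h : 0 <= cc * a0 * q by rewrite !mulr_ge0 ?ltW.
  rewrite /Q -!exprMn (_ : 4 * _ = (2 * n1) ^+ 2); last by ring.
  by rewrite ler_pXn2r ?nnegrE// (le_trans h).
have QC (E : R) : 0 <= E -> q ^+ 2 * E * rho ^+ 2 <= Q * (4 * E / cc ^+ 2 * (rho / a0) ^+ 2).
  move=> E0.
  rewrite [leRHS](_ : _ = (4 * Q) * (E * (rho / a0) ^+ 2 / cc ^+ 2)); last by ring.
  apply: le_trans (ler_wpM2r _ hQ); last first.
    by nonneg.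
  rewrite le_eqVlt; apply/orP; left; apply/eqP; field.
  by rewrite !gt_eqF.
have E10 : 0 <= 16 * B * (2 * B + 1) by nonneg.
have E20 : 0 <= 160 * B ^+ 2 * (2 * B + 1) by nonneg.
have qD : q ^+ 2 * (80 * B) <= D * (4 * Q * theta).
  apply: (@le_trans _ _ (q ^+ 2 * (D * (cc ^+ 2 * a0 ^+ 2 * theta)))).
    by rewrite ler_wpM2l ?sqr_ge0.
  rewrite [leLHS](_ : _ = D * ((cc ^+ 2 * a0 ^+ 2 * q ^+ 2) * theta)); last by ring.
  by rewrite ler_wpM2l ?(ltW D0)// ler_wpM2r ?(ltW th0).
have Q0 : 0 <= Q by apply: sqr_ge0.
have [brho|rhob] := leP b rho.
  apply: (le_trans N1); rewrite (mulrC W) -/Q.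
  rewrite [leRHS](_ : _ = len * (Q * (4 * (16 * B * (2 * B + 1)) / cc ^+ 2 * (rho / a0) ^+ 2) +
     Q * (4 * (160 * B ^+ 2 * (2 * B + 1)) / cc ^+ 2 * (rho / a0) ^+ 2) + Q * (theta * rho `^ s))); last by ring.
  rewrite ler_wpM2l// /W lerD//; last first.
    apply: (@le_trans _ _ (Q * (theta * b `^ s))); last first.
      by rewrite ler_wpM2l// ler_wpM2l ?(ltW th0)// ge0_ler_powR ?nnegrE ?(ltW s0) ?(ltW b0) ?(ltW rho0).
    have bs0 : 0 < b `^ s by rewrite powR_gt0.
    have : (q ^+ 2 * b `^ s) * (80 * B) <= D * (4 * Q * theta) * b `^ s.
      by rewrite mulrAC ler_wpM2r ?(ltW bs0).
    have : D * (80 * B) <= (q ^+ 2 * b `^ s) * (80 * B) by rewrite ler_wpM2r// mulr_ge0// ltW.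
    move=> h1 h2; have := le_trans h1 h2.
    rewrite -!mulrA ler_pM2l// !mulrA => h3; lra.
  rewrite -[leLHS]addr0; apply: lerD; last by nonneg.
  apply: le_trans (QC _ E10).
  rewrite [leRHS](_ : _ = 16 * B * q ^+ 2 * rho * (2 * B * rho + rho)); last by ring.
  by rewrite ler_wpM2l ?lerD2l//; nonneg.
have aV : a^-1 <= 2 * len / b.
  by rewrite ler_pdivlMr// mulrC ler_pdivrMr// -mulrA.
have h5 : 4 * B * rho / a + 1 <= 10 * B * rho * len / b.
  have ra : 1 <= rho / a by rewrite ler_pdivlMr// mul1r.
  apply: (@le_trans _ _ (5 * B * rho * a^-1)).
    by rewrite -!mulrA in ra *; nra.
  rewrite [leRHS](_ : _ = 5 * B * rho * (2 * len / b)); last by ring.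
  by rewrite ler_wpM2l//; nonneg.
have W0 : 0 <= W by rewrite /W; nonneg.
apply: (le_trans N2); apply: (le_trans (ler_wpM2l W0 h5)).
rewrite -/Q.
rewrite [leRHS](_ : _ = len * (Q * (4 * (160 * B ^+ 2 * (2 * B + 1)) / cc ^+ 2 * (rho / a0) ^+ 2) +
     Q * (4 * (16 * B * (2 * B + 1)) / cc ^+ 2 * (rho / a0) ^+ 2) + Q * (theta * rho `^ s))); last by ring.
rewrite [leLHS](_ : _ = len * (W * (10 * B * rho / b))); last by ring.
rewrite ler_wpM2l// /W mulrDl mul1r lerD//.
  rewrite -[leLHS]addr0; apply: lerD; last by nonneg.
  apply: le_trans (QC _ E20).
  rewrite [leRHS](_ : _ = 16 * B * q ^+ 2 * rho * (2 * B * b + b) * (10 * B * rho / b)); last first.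
    by field; rewrite gt_eqF.
  have ? : 0 <= 10 * B * rho / b by nonneg.
  rewrite ler_wpM2r// ler_wpM2l//; first by nonneg.
  by rewrite lerD2r ler_wpM2l// ?(ltW rhob)//; nonneg.
(* The end [a] is controlled by the second hypothesis on [D], the end [b] by the first multiplied by
   [b^(1 - s)]. *)
have rs : rho `^ (1 - s) <= 2 * q ^+ 2 * b / D.
  apply: (le_trans (powR_between _ a_gt0 arho (ltW rhob))).
  rewrite (_ : 2 * _ * _ / D = q ^+ 2 * b / D + q ^+ 2 * b / D); last by ring.
  apply: lerD; rewrite ler_pdivlMr// mulrC//.
  have bE : b = b `^ s * b `^ (1 - s).
    by rewrite -powRD ?(gt_eqF b0) ?implybT// addrC subrK powRr1// ltW.
  rewrite {2}bE mulrA ler_wpM2r ?powR_ge0//.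
have rE : rho = rho `^ s * rho `^ (1 - s).
  by rewrite -powRD ?(gt_eqF rho0) ?implybT// addrC subrK powRr1// ltW.
rewrite {1}rE (mulrC _ (_ `^ (1 - s))) !mulrA [leRHS]mulrC.
apply: (@le_trans _ _ (10 * B * (2 * q ^+ 2 * b / D) * rho `^ s / b)).
  rewrite ler_wpM2r ?invr_ge0 ?(ltW b0)// ler_wpM2r ?powR_ge0// ler_wpM2l// mulr_ge0//.
  exact: ltW.
rewrite [leLHS](_ : _ = rho `^ s * ((q ^+ 2 * (80 * B)) / (4 * D))); last first.
  by field; rewrite !gt_eqF.
rewrite ler_wpM2l ?powR_ge0// ler_pdivrMr ?mulr_gt0//; lra.
Qed.

End ReturnSets.

Section Ubiquity.
Local Open Scope classical_set_scope.
Context {R : realType}.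

Definition return_set (A : 'M[int]_2) (r : nat -> R) (n : nat) : set 'cV[R]_2 :=
  [set u | exists2 k, k \is a mxOver Num.int &
    edist (iter n (mulmx (map_mx intr A)) u - u) k < r n].

Context {A : 'M[int]_2} {l mu : R} {xi eta : 'cV[R]_2 -> R} {mk : R -> R -> 'cV[R]_2} {B : R}.
Hypothesis F : hyperbolic_frame A l mu xi eta mk B.

Lemma frame_xi_iter n u : xi (iter n (mulmx (map_mx intr A)) u) = l ^+ n * xi u.
Proof. by elim: n => [|n IH] /=; rewrite ?expr0 ?mul1r// (frame_xiA F) IH exprS mulrA. Qed.

Lemma frame_eta_iter n u : eta (iter n (mulmx (map_mx intr A)) u) = mu ^+ n * eta u.
Proof. by elim: n => [|n IH] /=; rewrite ?expr0 ?mul1r// (frame_etaA F) IH exprS mulrA. Qed.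

Lemma iter_mulmx_int n (z : 'cV[R]_2) : z \is a mxOver Num.int ->
  iter n (mulmx (map_mx intr A)) z \is a mxOver Num.int.
Proof.
move=> zi; elim: n => //= n IH; apply: mxOverM => //.
by apply/mxOverP => i j; rewrite mxE; exact: intr_int.
Qed.

Lemma frame_edist_le u v (x y : R) : `|xi (u - v)| <= x -> `|eta (u - v)| <= y ->
  edist u v <= 2 * (B * (x + y)).
Proof.
move=> hx hy; apply: (le_trans (edist_le_norm _ _)); rewrite ler_wpM2l//.
apply: (le_trans (frame_le F _)); rewrite ler_wpM2l ?lerD//.
by rewrite (le_trans _ (frame_B F)).
Qed.

Lemma even_power L i : `|l| = expR L ->
  l ^+ (2 * i) = expR (2 * L * i%:R) /\ mu ^+ (2 * i) = (expR (2 * L * i%:R))^-1.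
Proof.
move=> lL; have lE : l ^+ (2 * i) = expR (2 * L * i%:R).
  rewrite exprM -real_normK ?num_real// lL -exprM -expRM_natl; congr expR.
  by rewrite natrM; ring.
split=> //; rewrite -lE; apply/eqP; rewrite -div1r eq_sym; apply/eqP.
apply: (canLR (mulfK _)); first by rewrite lE gt_eqF// expR_gt0.
by rewrite -exprMn (mulrC mu) exprM -real_normK ?num_real// (frame_lmu F) !expr1n.
Qed.

(* With [sigma (mk x y) = mk x (-y)], the solutions [w] of [A^n w - w] integer are
   exactly [sigma z / q] for [z] integer, when [n = 4 i]. *)
Lemma return_center (L : R) i (z y : 'cV[R]_2) (t a b : R) :
  `|l| = expR L -> 0 < L -> (0 < i)%N -> z \is a mxOver Num.int ->
  let lam := expR (2 * L * i%:R) in let q := lam - lam^-1 in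
  `|t| <= b -> `|y - mk (xi z / q) (- eta z / q + t)| <= a ->
  exists2 k, k \is a mxOver Num.int &
    edist (iter (4 * i) (mulmx (map_mx intr A)) y - y) k
      <= 2 * (B * (lam ^+ 2 * (B * a) + (b + B * a))).
Proof.
move=> lL L0 i0 zi lam q tb ya.
(* With [w] the centre [sigma z / q], this is [A^n w - w] for [n = 4 i]. *)
exists (iter (2 * i) (mulmx (map_mx intr A)) z); first exact: iter_mulmx_int.
have [lE muE] := even_power i lL; rewrite -/lam in lE muE.
have lam1 : 1 < lam by rewrite expR_gt1// !mulr_gt0// ltr0n.
have lam0 : 0 < lam by apply: lt_trans lam1.
have lamV : 0 < lam^-1 < 1 by rewrite invr_gt0 lam0 invf_lt1.
have q0 : q != 0 by rewrite gt_eqF// /q; move: lamV => /andP[_]; lra.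
have lamN : lam != 0 by rewrite gt_eqF.
have B0 : 0 < B by apply: lt_le_trans (frame_B F).
set w := mk _ _ in ya.
have xv : `|xi y - xi z / q| <= B * a.
  rewrite -[X in _ - X](frame_xi_mk F _ (- eta z / q + t)) -(frame_xiB F).
  by apply: (le_trans (frame_xi_le F _)); rewrite ler_wpM2l// ltW.
have ev : `|eta y - (- eta z / q + t)| <= B * a.
  rewrite -[X in _ - X](frame_eta_mk F (xi z / q)) -(frame_etaB F).
  by apply: (le_trans (frame_eta_le F _)); rewrite ler_wpM2l// ltW.
have e4 : (4 * i = (2 * i) + (2 * i))%N by rewrite -mulnDl.
apply: frame_edist_le.
  rewrite !(frame_xiB F) !frame_xi_iter e4 exprD lE.
  have -> : lam * lam * xi y - xi y - lam * xi z = (lam ^+ 2 - 1) * (xi y - xi z / q).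
    have -> : lam ^+ 2 - 1 = q * lam by rewrite /q; field.
    have -> : lam * lam * xi y - xi y = q * lam * xi y by rewrite /q; field.
    by field.
  have l2 : 0 <= lam ^+ 2 - 1 by nra.
  rewrite normrM (ger0_norm l2); apply: ler_pM => //; lra.
rewrite !(frame_etaB F) !frame_eta_iter e4 exprD muE.
have -> : lam^-1 * lam^-1 * eta y - eta y - lam^-1 * eta z =
    - ((1 - lam^-1 * lam^-1) * (eta y - (- eta z / q + t) + t)).
  have qE : 1 - lam^-1 * lam^-1 = q * lam^-1 by rewrite /q; field.
  have -> : lam^-1 * lam^-1 * eta y - eta y = - ((1 - lam^-1 * lam^-1) * eta y) by ring.
  by rewrite qE; field; rewrite q0 lamN.
move/andP: lamV => [lamV0 lamV1].
have l2 : 0 <= 1 - lam^-1 * lam^-1 <= 1 by apply/andP; split; nra.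
rewrite normrN normrM ger0_norm; last by case/andP: l2.
apply: (@le_trans _ _ (1 * (B * a + b))); last by rewrite mul1r addrC.
apply: ler_pM => //; [by case/andP: l2| by case/andP: l2|].
by rewrite (le_trans (ler_normD _ _))// lerD.
Qed.

Lemma floor_shift_le (x y b : R) : 0 <= y -> y + 1 <= b -> `|(Num.floor x)%:~R + y - x| <= b.
Proof.
move=> y0 yb; have /andP[f1 f2] := floor_itv x; rewrite rmorphD /= in f2.
by rewrite ler_norml; apply/andP; split; lra.
Qed.

Lemma return_ubiquitous (alpha L s : R) : 0 < alpha -> 0 < L -> `|l| = expR L ->
  0 < s -> s < 2 * L / (alpha + L) -> s < L / alpha ->
  ubiquitous s (return_set A (fun n => expR (- (alpha * n%:R)))).
Proof.
move=> alpha0 L0 lL s0 s1 s2.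
have B1 := frame_B F; have B0 : 0 < B by apply: lt_le_trans B1.
(* [k1] and [k2] keep the return distance given by [return_center] within [e / 4]; [cc] keeps the
   centres within [a0 / 2] of [p]. *)
pose k1 := (16 * B)^-1; pose k2 := (32 * B ^+ 2)^-1; pose cc := (8 * B ^+ 2)^-1.
have B2 : 0 < B ^+ 2 by rewrite exprn_gt0.
have k10 : 0 < k1 by rewrite invr_gt0 mulr_gt0.
have k20 : 0 < k2 by rewrite invr_gt0 mulr_gt0.
have cc0 : 0 < cc by rewrite invr_gt0 mulr_gt0.
exists ((64 * B * (2 * B + 1) + 640 * B ^+ 2 * (2 * B + 1)) / cc ^+ 2).
  have B21 : 0 < 2 * B + 1 by lra.
  apply: divr_gt0; last exact: exprn_gt0.
  apply: addr_gt0; (apply: mulr_gt0; last exact: B21).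
    by apply: mulr_gt0; first by rewrite ltr0n.
  by apply: mulr_gt0; first by rewrite ltr0n.
move=> a0 theta n0 a00 th0.
have a034 : a0 / 2 + a0 / 4 <= a0 by lra.
have ct0 : 0 < cc ^+ 2 * a0 ^+ 2 * theta by rewrite !mulr_gt0// exprn_gt0.
(* Each summand serves one requirement: on [q], on [b], twice on [a], and in [count_numerics]. *)
pose D := 8 * B ^+ 2 / a0 + 4 * B / a0 + theta^-1 + 4 / a0 + 80 * B / (cc ^+ 2 * a0 ^+ 2 * theta).
have d1 : 0 < 8 * B ^+ 2 / a0 by rewrite divr_gt0// mulr_gt0.
have d2 : 0 < 4 * B / a0 by rewrite divr_gt0// mulr_gt0.
have d3 : 0 < theta^-1 by rewrite invr_gt0.
have d4 : 0 < 4 / a0 by rewrite divr_gt0.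
have d5 : 0 < 80 * B / (cc ^+ 2 * a0 ^+ 2 * theta) by rewrite divr_gt0// mulr_gt0.
have D0 : 0 < D by rewrite !addr_gt0.
have [i0 iP] := scales_eventually alpha0 L0 k10 k20 s0 D0 s1 s2.
pose i := (maxn i0 n0).+1.
have [] := iP i (leqW (leq_maxl _ _)).
set lam := expR (2 * L * i%:R); set q := lam - lam^-1.
set e := expR _; set b := k1 * e; set a := k2 * e * lam ^- 2.
move=> lamq Dq Db Da [Dqb Dqa].
have e0 : 0 < e by apply: expR_gt0.
have lam1 : 1 < lam by rewrite expR_gt1// !mulr_gt0// ltr0n.
have lam0 : 0 < lam by apply: lt_trans lam1.
have b0 : 0 < b by rewrite mulr_gt0.
have a_gt0 : 0 < a by rewrite !mulr_gt0// invr_gt0 exprn_gt0.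
have q0 : 0 < q by apply: lt_le_trans Dq.
have ba : b / a = 2 * B * lam ^+ 2.
  by rewrite /b /a /k1 /k2; field; rewrite !gt_eqF.
have ba1 : 1 <= b / a by rewrite ba; nra.
pose len := Num.truncn (b / a).
have /andP[len1 len2] := truncn_itv (le_trans ler01 ba1).
have len0 : (0 < len)%N by rewrite truncn_gt0.
have lena : len%:R * a <= b by rewrite -ler_pdivlMr.
have len_ge1 : 1 <= len%:R :> R by rewrite ler1n.
have alen : b <= 2 * (len%:R * a).
  rewrite mulrA -ler_pdivrMr//; rewrite -natr1 -/len in len2; lra.
have cq1 : 1 <= cc * a0 * q.
  have h : 8 * B ^+ 2 / a0 <= q by apply: le_trans Dq; rewrite /D; lra.
  rewrite /cc -mulrA ler_pdivlMl ?mulr_gt0// mulr1.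
  by move: h; rewrite ler_pdivrMr// (mulrC q).
pose n1 := Num.truncn (cc * a0 * q).
have /andP[n11 n12] := truncn_itv (le_trans ler01 cq1).
have n1_gt0 : (0 < n1)%N by rewrite truncn_gt0.
have n1_ge1 : 1 <= n1%:R :> R by rewrite ler1n.
have n1q : cc * a0 * q <= 2 * n1%:R by rewrite -natr1 -/n1 in n12; lra.
have D_le (x : R) : D * x <= 1 -> forall y, 0 < y -> y^-1 <= D -> x <= y.
  move=> Dx y y0 yD; have [x0|x0] := leP x 0; first by rewrite (le_trans x0)// ltW.
  have : y^-1 * x <= 1 by apply: le_trans Dx; rewrite ler_wpM2r// ltW.
  by rewrite ler_pdivrMl// mulr1.
have a_th : a <= theta by apply: (D_le _ Da) => //; rewrite /D; lra.
have a_a0 : a <= a0 / 4.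
  by apply: (D_le _ Da); [rewrite divr_gt0|rewrite invf_div /D; lra].
have b_a0 : b <= a0 / (4 * B).
  by apply: (D_le _ Db); [rewrite divr_gt0// mulr_gt0|rewrite invf_div /D; lra].
exists (4 * i)%N, a, (n1 * n1 * len)%N; split => //.
- by rewrite (leq_trans (leq_trans (leq_maxr i0 n0) (leqnSn _)))// -/i leq_pmull.
- by rewrite !muln_gt0 n1_gt0 len0.
move=> p.
(* [P] is [q * sigma p], so an integer vector [z] near [P] gives a periodic point [sigma z / q] near
   [p]. *)
pose P := mk (q * xi p) (- (q * eta p)).
pose z (ij : 'I_n1 * 'I_n1) : 'cV[R]_2 :=
  \col_t ((Num.floor (P t 0))%:~R + (if t == 0 then ij.1 : nat else ij.2 : nat)%:R).
have zint ij : z ij \is a mxOver Num.int.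
  by apply/mxOverP => t t'; rewrite mxE rpredD// ?intr_int// natr_int.
have zinj : injective z.
  move=> [j1 j2] [j1' j2'] h.
  have h0 := congr1 (fun u : 'cV[R]_2 => u 0 0) h; have h1 := congr1 (fun u : 'cV[R]_2 => u 1 0) h.
  move: h0 h1; rewrite /= !mxE /= => /addrI /eqP; rewrite eqr_nat => /eqP/val_inj ->.
  by move=> /addrI /eqP; rewrite eqr_nat => /eqP/val_inj ->.
have zP ij : `|z ij - P| <= n1%:R.
  apply/cV_norm_le => // t; rewrite !mxE.
  apply: floor_shift_le; rewrite ?ler0n// natr1 ler_nat; case: ifP => _; exact: ltn_ord.
pose ctr (j : ('I_n1 * 'I_n1) * 'I_len) :=
  mk (xi (z j.1) / q) (- eta (z j.1) / q + j.2%:R * a).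
have ta (t : 'I_len) : 0 <= t%:R * a <= b.
  rewrite mulr_ge0 ?(ltW a_gt0)//= (le_trans _ lena)// ler_wpM2r ?(ltW a_gt0)//.
  by rewrite ler_nat ltnW.
exists (map ctr (enum {: ('I_n1 * 'I_n1) * 'I_len})); split.
- by rewrite size_map -cardE !card_prod !card_ord.
- move=> _ /mapP[[ij t] _ ->]; split.
    have xP : `|xi (ctr (ij, t) - p)| <= B * n1%:R / q.
      rewrite (frame_xiB F) (frame_xi_mk F) /=.
      have -> : xi (z ij) / q - xi p = xi (z ij - P) / q.
        by rewrite (frame_xiB F) (frame_xi_mk F); field; rewrite gt_eqF.
      rewrite normrM normfV (gtr0_norm q0) ler_wpM2r ?invr_ge0 ?(ltW q0)//.
      by apply: (le_trans (frame_xi_le F _)); rewrite ler_wpM2l// ltW.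
    have eP : `|eta (ctr (ij, t) - p)| <= B * n1%:R / q + b.
      rewrite (frame_etaB F) (frame_eta_mk F) /=.
      have -> : - eta (z ij) / q + t%:R * a - eta p = - (eta (z ij - P) / q) + t%:R * a.
        by rewrite (frame_etaB F) (frame_eta_mk F); field; rewrite gt_eqF.
      have /andP[t1 t2] := ta t.
      rewrite (le_trans (ler_normD _ _))// lerD ?(ger0_norm t1)// normrN.
      rewrite normrM normfV (gtr0_norm q0) ler_wpM2r ?invr_ge0 ?(ltW q0)//.
      by apply: (le_trans (frame_eta_le F _)); rewrite ler_wpM2l// ltW.
    have nq : B * n1%:R / q <= a0 / (8 * B).
      rewrite ler_pdivrMr//; apply: (@le_trans _ _ (B * (cc * a0 * q))).
        by rewrite ler_wpM2l// ltW.
      by rewrite /cc le_eqVlt; apply/orP; left; apply/eqP; field; rewrite gt_eqF.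
    have BE : B * (a0 / (8 * B) + (a0 / (8 * B) + a0 / (4 * B))) = a0 / 2.
      by field; rewrite gt_eqF.
    apply: (@le_trans _ _ (a0 / 2 + a0 / 4)) => //.
    apply: lerD => //; apply: (le_trans (frame_le F _)).
    by rewrite -BE ler_wpM2l ?(ltW B0)// lerD ?(le_trans xP)// (le_trans eP)// lerD.
  move=> y yc; have /andP[t1 t2] := ta t.
  have tb : `|t%:R * a| <= b by rewrite ger0_norm.
  have [k ki kd] := return_center lL L0 (ltn0Sn _) (zint ij) tb yc.
  exists k => //; apply: (le_lt_trans kd).
  have -> : expR (- (alpha * (4 * i)%:R)) = e by rewrite /e natrM; congr expR; ring.
  rewrite -/lam.
  have -> : lam ^+ 2 * (B * a) = B * k2 * e by rewrite /a; field; rewrite gt_eqF.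
  have Bk2 : B * (B * k2) = 32^-1 by rewrite /k2; field; rewrite gt_eqF.
  have Bk1 : B * k1 = 16^-1 by rewrite /k1; field; rewrite gt_eqF.
  have ae : a <= k2 * e.
    by rewrite /a ler_piMr ?mulr_ge0 ?(ltW k20) ?(ltW e0)// invf_le1 ?exprn_gt0// exprn_ege1// ltW.
  apply: (@le_lt_trans _ _ (2 * (B * (B * k2) * e + (B * k1 * e + B * (B * k2) * e)))).
    have -> : B * (B * k2 * e + (b + B * a)) = B * (B * k2) * e + (B * k1 * e + B * (B * a)).
      by rewrite /b; ring.
    rewrite ler_wpM2l// !lerD2l -!mulrA ler_wpM2l ?(ltW B0)// ler_wpM2l//.
    exact: ltW.
  by rewrite Bk2 Bk1; lra.
move=> x rho arho; rewrite count_map count_enum.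
rewrite (_ : (n1 * n1 * len)%:R = n1%:R ^+ 2 * len%:R :> R); last by rewrite !natrM expr2.
have [c1 c2] := count_centers F x zinj zint q0 a_gt0 arho b0 lena.
apply: (@count_numerics _ B cc a0 q a b rho theta s D) => //.
by rewrite -ler_pdivrMr// lerDr !addr_ge0// ltW.
Qed.

End Ubiquity.

(** * Recurrence on the torus *)

Section TorusReturns.
Local Open Scope classical_set_scope.
Local Open Scope quotient_scope.
Context {R : realType}.
Local Notation T2 := (torus R 2).

Lemma edist_opp n (u v : 'cV[R]_n) : edist u v = edist v u.
Proof. by congr Num.sqrt; apply: eq_bigr => i _; rewrite -sqrrN opprB. Qed.

Lemma edist_eq_sub n (u v u' v' : 'cV[R]_n) : u - v = u' - v' -> edist u v = edist u' v'.
Proof. by move=> e; rewrite edistB e -edistB. Qed.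

Lemma int_vecN n (u : 'cV[R]_n) : u \is a mxOver Num.int -> - u \is a mxOver Num.int.
Proof. by move=> /mxOverP ui; apply/mxOverP => i j; rewrite !mxE rpredN. Qed.

Lemma torus_iter (A : 'M[int]_2) n u :
  iter n (torus_map A) (\pi_T2 u) = \pi_T2 (iter n (mulmx (map_mx intr A)) u).
Proof. by elim: n => //= n ->; rewrite torus_mapE. Qed.

Definition reps_dist (x y : T2) : set R :=
  [set edist u v | u in [set u | \pi_T2 u = x] & v in [set v | \pi_T2 v = y]].

Lemma reps_dist_has_inf x y : has_inf (reps_dist x y).
Proof.
split.
  by exists (edist (repr x) (repr y)), (repr x); [rewrite /= reprK|exists (repr y); rewrite /= ?reprK].
by exists 0 => _ [u _ [v _ <-]]; exact: edist_ge0.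
Qed.

Lemma torus_dist_le (u v : 'cV[R]_2) : torus_dist (\pi_T2 u) (\pi_T2 v) <= edist u v.
Proof.
have [_ lb] := reps_dist_has_inf (\pi_T2 u) (\pi_T2 v).
by apply: (ge_inf lb); exists u => //; exists v.
Qed.

Lemma torus_dist_ge0 (x y : T2) : 0 <= torus_dist x y.
Proof.
apply: lb_le_inf; first by case: (reps_dist_has_inf x y).
by move=> _ [u _ [v _ <-]]; exact: edist_ge0.
Qed.

Lemma torus_dist_lt (u v : 'cV[R]_2) (r : R) :
  torus_dist (\pi_T2 u) (\pi_T2 v) < r <->
  exists2 k, k \is a mxOver Num.int & edist (v - u) k < r.
Proof.
split => [h|[k ki kr]].
  have r0 : 0 < r - torus_dist (\pi_T2 u) (\pi_T2 v) by rewrite subr_gt0.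
  have [_ [u' /= u'u [v' /= v'v <-]]] := inf_adherent r0 (reps_dist_has_inf (\pi_T2 u) (\pi_T2 v)).
  rewrite -/(torus_dist _ _) subrKC => uvr.
  move/pi_torusP: u'u => u'u; move/pi_torusP: v'v => v'v.
  exists ((u' - u) - (v' - v)); first exact: int_vecB.
  by rewrite (edist_eq_sub (u' := v') (v' := u')) 1?edist_opp//; apply/matrixP => i j; rewrite !mxE; ring.
apply: le_lt_trans kr.
have -> : \pi_T2 u = \pi_T2 (u + k).
  by apply/pi_torusP; rewrite opprD addNKr; exact: int_vecN.
apply: (le_trans (torus_dist_le _ _)).
rewrite edist_opp (edist_eq_sub (u' := v - u) (v' := k))//.
by apply/matrixP => i j; rewrite !mxE; ring.
Qed.

(** Representatives differing from [u], [v] by distinct integer vectors are at max distance at least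
    3/4, while [edist u v] is at most 1/2. A small square thus embeds isometrically, which brings
    the lower bound down to the torus. *)
Lemma edist_le_torus_dist (u v : 'cV[R]_2) : `|u| <= 8^-1 -> `|v| <= 8^-1 ->
  edist u v <= torus_dist (\pi_T2 u) (\pi_T2 v).
Proof.
move=> u8 v8; apply: lb_le_inf; first by case: (reps_dist_has_inf (\pi_T2 u) (\pi_T2 v)).
move=> _ [u' /= /pi_torusP u'u [v' /= /pi_torusP v'v <-]].
pose w := (u' - u) - (v' - v).
have [w0|w0] := eqVneq w 0.
  rewrite (edist_eq_sub (u' := u') (v' := v'))//; apply/matrixP => i j.
  by have := congr1 (fun M : 'cV[R]_2 => M i j) w0; rewrite /w !mxE; lra.
have /mxOverP wint : w \is a mxOver Num.int by exact: int_vecB.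
have [i wi] : exists i, w i 0 != 0.
  apply/existsP; apply: contraNT w0 => /existsPn h.
  by apply/eqP/colP => i; rewrite [RHS]mxE; apply/eqP; have := h i; rewrite negbK.
have w1 : 1 <= `|w i 0| by apply: norm_intr_ge1.
have uv : `|u - v| <= 4^-1 by rewrite (le_trans (ler_normB _ _))//; lra.
have h1 := cV_coord_le (u - v) i; have h2 := cV_coord_le (u' - v') i.
have : `|w i 0| <= `|(u' - v') i 0| + `|(u - v) i 0|.
  by apply: le_trans (ler_normB _ _); rewrite /w !mxE le_eqVlt; apply/orP; left; apply/eqP; congr `|_|; ring.
have := norm_le_edist u' v'; have := edist_le_norm u v; lra.
Qed.

Lemma infinite_setNP (P : set nat) :
  infinite_set P <-> forall N, exists2 n, (N <= n)%N & P n.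
Proof.
split => [Pinf N|h /finite_seqP[s Ps]].
  apply: contrapT => /forall2NP h; apply: Pinf; apply: sub_finite_set (finite_II N) => n Pn /=.
  by have [/negP|//] := h n; rewrite -ltnNge.
have [n sn] := h (\max_(i <- s) i).+1; rewrite Ps /= => ns.
by have := @leq_bigmax_seq _ s xpredT id n ns isT; rewrite leqNgt sn.
Qed.

Lemma recurrent_liftP (A : 'M[int]_2) (r : nat -> R) u :
  recurrent_set (torus_map A) r (\pi_T2 u) <->
  forall N, exists2 n, (N <= n)%N & (1 <= n)%N /\ return_set A r n u.
Proof.
rewrite /recurrent_set /= infinite_setNP; split => h N; have [n Nn [n1 hn]] := h N;
  exists n => //; split => //; move: hn; rewrite /torus_ball /= torus_iter.
  by move=> /torus_dist_lt.
by move=> ?; apply/torus_dist_lt.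
Qed.

Lemma coord_iter_continuous (M : 'M[R]_2) n (i : 'I_2) :
  continuous (fun u : 'cV[R]_2 => iter n (mulmx M) u i 0).
Proof.
elim: n i => [|n IH] i x /=; first exact: coord_continuous.
have -> : (fun u : 'cV[R]_2 => (M *m iter n (mulmx M) u) i 0) =
    (fun u => M i 0 * iter n (mulmx M) u 0 0 + M i 1 * iter n (mulmx M) u 1 0).
  apply/funext => u; rewrite mxE !big_ord_recl big_ord0 addr0.
  by rewrite (_ : lift 0 0 = 1)//; exact/val_inj.
apply: (@continuousD _ _ _ (fun u : 'cV[R]_2 => M i 0 * iter n (mulmx M) u 0 0)
    (fun u => M i 1 * iter n (mulmx M) u 1 0)).
  by apply: continuousM; [exact: cst_continuous|exact: IH].
by apply: continuousM; [exact: cst_continuous|exact: IH].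
Qed.

Lemma return_set_open (A : 'M[int]_2) (r : nat -> R) n : open (return_set A r n).
Proof.
rewrite (_ : return_set A r n = \bigcup_(k in [set k | k \is a mxOver Num.int])
  [set u | edist (iter n (mulmx (map_mx intr A)) u - u) k < r n]); last first.
  by apply/seteqP; split => u [k ki kr]; exists k.
apply: bigcup_open => k _.
apply: (@open_comp _ _ (fun u : 'cV[R]_2 => edist (iter n (mulmx (map_mx intr A)) u - u) k)
  [set t : R | t < r n]); last exact: open_lt.
move=> u _; rewrite /edist.
apply: (@continuous_comp _ _ _ (fun u => \sum_(i < 2) _) Num.sqrt); last exact: sqrt_continuous.
have term (i : 'I_2) : {for u, continuous (fun u : 'cV[R]_2 =>
    ((iter n (mulmx (map_mx intr A)) u - u) i 0 - k i 0) ^+ 2)}.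
  have -> : (fun u : 'cV[R]_2 => ((iter n (mulmx (map_mx intr A)) u - u) i 0 - k i 0) ^+ 2) =
      (fun u => (iter n (mulmx (map_mx intr A)) u i 0 - u i 0 - k i 0) *
                (iter n (mulmx (map_mx intr A)) u i 0 - u i 0 - k i 0)).
    by apply/funext => v; rewrite !mxE expr2.
  have c : {for u, continuous (fun v : 'cV[R]_2 =>
      iter n (mulmx (map_mx intr A)) v i 0 - v i 0 - k i 0)}.
    apply: (@continuousB _ _ _ (fun v : 'cV[R]_2 =>
      iter n (mulmx (map_mx intr A)) v i 0 - v i 0) (cst (k i 0))); last exact: cst_continuous.
    apply: (@continuousB _ _ _ (fun v : 'cV[R]_2 => iter n (mulmx (map_mx intr A)) v i 0)
      (fun v => v i 0)); [exact: coord_iter_continuous|exact: coord_continuous].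
  by apply: continuousM.
have -> : (fun u : 'cV[R]_2 => \sum_(i < 2) ((iter n (mulmx (map_mx intr A)) u - u) i 0 - k i 0) ^+ 2) =
    (fun u => ((iter n (mulmx (map_mx intr A)) u - u) 0 0 - k 0 0) ^+ 2 +
              ((iter n (mulmx (map_mx intr A)) u - u) 1 0 - k 1 0) ^+ 2).
  apply/funext => v; rewrite !big_ord_recl big_ord0 addr0.
  by rewrite (_ : lift 0 0 = 1)//; exact/val_inj.
by apply: (@continuousD _ _ _ (fun u : 'cV[R]_2 =>
  ((iter n (mulmx (map_mx intr A)) u - u) 0 0 - k 0 0) ^+ 2)); exact: term.
Qed.

Lemma recurrent_lift_Gdelta (A : 'M[int]_2) (r : nat -> R) :
  Gdelta (\pi_T2 @^-1` recurrent_set (torus_map A) r).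
Proof.
exists (fun N => \bigcup_(n in [set n | (N <= n)%N /\ (1 <= n)%N]) return_set A r n).
  by move=> N; apply: bigcup_open => n _; exact: return_set_open.
apply/seteqP; split => [u /recurrent_liftP h N _|u h].
  by have [n Nn [n1 hn]] := h N; exists n.
by apply/recurrent_liftP => N; have [n [Nn n1] hn] := h N I; exists n.
Qed.

Lemma content_limsup_gt0 (s a0 : R) (V : nat -> nat -> set 'cV[R]_2) :
  0 < s < 2 -> 0 < a0 -> (forall i, ubiquitous s (V i)) ->
  (0 < hausdorff_content edist s 1
    [set y : 'cV[R]_2 | (`|y| <= a0)%R /\ forall i N, exists2 n, (N <= n)%N & V i n y])%E.
Proof.
move=> s02 a00 ubi.
have [K K0 cov] := cantor_cover (cV_compact_cball (n := 2)) 0 s02 a00 ubi.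
have [s0 _] := andP s02.
apply: (hausdorff_content_gt0 (@norm_le_edist R 2) s0 K0) => x rho rho0 xcov.
by apply: cov => // y; rewrite subr0 => ya hy; apply: xcov.
Qed.

Lemma similarity_inj n (f : 'cV[R]_n -> 'cV[R]_n) : similarity f -> injective f.
Proof.
move=> [c c0 fc] u v e; have := fc u v; rewrite e.
have -> : edist (f v) (f v) = 0.
  by rewrite /edist big1 ?sqrtr0// => i _; rewrite subrr expr0n.
move=> /esym/eqP; rewrite mulf_eq0 (gt_eqF c0)/= => /eqP uv.
apply/eqP; rewrite -subr_eq0 -normr_le0 -uv; exact: norm_le_edist.
Qed.

Lemma recurrent_large_intersection (A : 'M[int]_2) (r : nat -> R) (s0 : R) : s0 <= 2 ->
  (forall s, 0 < s < s0 -> ubiquitous s (return_set A r)) ->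
  torus_large_intersection s0 (recurrent_set (torus_map A) r).
Proof.
move=> s02 ubi; split; first exact: recurrent_lift_Gdelta.
move=> f fsim.
pose S := [set y : 'cV[R]_2 | `|y| <= 1 /\
  forall i N, exists2 n, (N <= n)%N & (f i @` return_set A r n) y].
apply: (hausdorff_dim_ge (dX := edist) (phi := id) (S := S)) => //; first exact: edist_ge0.
  (* By injectivity of [f i], the preimages of [y] found at different times are one point [x], which
     therefore returns infinitely often. *)
  move=> y [_ hy] i _; have [n0 _ [x _ xy]] := hy i 0%N.
  exists x => //; apply/recurrent_liftP => N.
  have [n Nn [x' hx' x'y]] := hy i (maxn N 1).
  exists n; first exact: leq_trans (leq_maxl _ _) Nn.
  split; first exact: leq_trans (leq_maxr N _) Nn.
  by rewrite (similarity_inj (fsim i) (etrans xy (esym x'y))).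
move=> s /andP[sgt0 slt]; apply: content_limsup_gt0 => //.
  by rewrite sgt0 (lt_le_trans slt).
by move=> i; apply: ubiquitous_similarity => //; apply: ubi; rewrite sgt0.
Qed.

Lemma recurrent_dim_ge (A : 'M[int]_2) (r : nat -> R) (s0 : R) : s0 <= 2 ->
  (forall s, 0 < s < s0 -> ubiquitous s (return_set A r)) ->
  (s0%:E <= hausdorff_dim torus_dist (recurrent_set (torus_map A) r))%E.
Proof.
move=> s02 ubi.
pose S := [set y : 'cV[R]_2 | `|y| <= 8^-1 /\
  forall i N : nat, exists2 n, (N <= n)%N & return_set A r n y].
apply: (hausdorff_dim_ge (dX := edist) (phi := \pi_T2) (S := S)).
- exact: edist_ge0.
- move=> y [_ hy]; apply/recurrent_liftP => N.
  have [n Nn hn] := hy 0%N (maxn N 1); exists n; first exact: leq_trans (leq_maxl _ _) Nn.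
  by split => //; exact: leq_trans (leq_maxr N _) Nn.
- by move=> u v [u8 _] [v8 _]; exact: edist_le_torus_dist.
move=> s /andP[sgt0 slt]; apply: content_limsup_gt0; rewrite ?invr_gt0//.
  by rewrite sgt0 (lt_le_trans slt).
by move=> i; apply: ubi; rewrite sgt0.
Qed.

End TorusReturns.

(** * Upper bound for the dimension *)

Section UpperBound.
Local Open Scope classical_set_scope.
Local Open Scope quotient_scope.
Context {R : realType}.
Local Notation T2 := (torus R 2).

Lemma torus_repr_unit (x : T2) : exists2 u : 'cV[R]_2, x = \pi_T2 u & `|u| <= 1.
Proof.
exists (\col_i (repr x i 0 - (Num.floor (repr x i 0))%:~R)).
  rewrite -[LHS]reprK; apply/pi_torusP/mxOverP => i j; rewrite !mxE ord1 opprB addrC subrK.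
  exact: intr_int.
apply/cV_norm_le => // i; rewrite !mxE.
have /andP[f1 f2] := floor_itv (repr x i 0); rewrite rmorphD /= in f2.
by rewrite ger0_norm; lra.
Qed.

Context {A : 'M[int]_2} {l mu : R} {xi eta : 'cV[R]_2 -> R} {mk : R -> R -> 'cV[R]_2} {B : R}.
Hypothesis F : hyperbolic_frame A l mu xi eta mk B.

Lemma frame_mu : `|mu| = `|l|^-1.
Proof.
have l0 : `|l| != 0 by rewrite gt_eqF// (lt_trans ltr01 (frame_l F)).
by apply: (mulfI l0); rewrite mulfV// -normrM (frame_lmu F).
Qed.

(** Here and in [frame_contract] the factor does not depend on [n]: comparing displacements bounds
    the distance of two points, with a gain [|l|^n] in [xi] and none in [eta]. *)
Lemma frame_expand n : (0 < n)%N -> (1 - `|l|^-1) * `|l| ^+ n <= `|l ^+ n - 1|.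
Proof.
move=> n0; have l1 := frame_l F; have l0 : 0 < `|l| by apply: lt_trans l1.
apply: le_trans (lerB_dist _ _); rewrite normr1 normrX.
rewrite mulrBl mul1r lerD2l lerN2; case: n n0 => // n _.
by rewrite exprS mulKf ?gt_eqF// exprn_ege1// ltW.
Qed.

Lemma frame_contract n : (0 < n)%N -> 1 - `|l|^-1 <= `|mu ^+ n - 1|.
Proof.
move=> n0; have l1 := frame_l F; have l0 : 0 < `|l| by apply: lt_trans l1.
rewrite distrC; apply: le_trans (lerB_dist _ _); rewrite normr1 normrX frame_mu.
rewrite lerD2l lerN2; case: n n0 => // n _.
rewrite exprS ler_piMr ?invr_ge0//.
by rewrite exprn_ile1 ?invr_ge0// invf_le1// ltW.
Qed.

Lemma frame_iterB n (u k : 'cV[R]_2) :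
  let v := iter n (mulmx (map_mx intr A)) u - u - k in
  xi v = (l ^+ n - 1) * xi u - xi k /\ eta v = (mu ^+ n - 1) * eta u - eta k.
Proof.
by split; rewrite ?(frame_xiB F) ?(frame_etaB F) ?(frame_xi_iter F) ?(frame_eta_iter F)
  mulrBl mul1r.
Qed.

(* At time [n] the returning points form about [|l|^n] ellipses, of semi-axes
   comparable to [r |l|^-n] and [r]; each ellipse is cut into about [Om]
   pieces of diameter comparable to [r / Om]. *)
Lemma return_cover n (r Om : R) : (0 < n)%N -> 0 < r -> r <= 1 -> 1 <= Om -> Om <= `|l| ^+ n ->
  exists (N : nat) (W : nat -> set T2),
  [/\ N%:R <= 219 * B ^+ 2 * (`|l| ^+ n * Om),
    forall j x y, W j x -> W j y ->
      torus_dist x y <= 8 * B ^+ 2 / (1 - `|l|^-1) * (r / Om) &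
    forall u, `|u| <= 1 -> (exists2 k, k \is a mxOver Num.int &
        edist (iter n (mulmx (map_mx intr A)) u - u) k < r) ->
      exists2 j, (j < N)%N & W j (\pi_T2 u)].
Proof.
move=> n0 r0 r1 Om1 OmL; set Lam := `|l| ^+ n in OmL *; set c := 1 - `|l|^-1.
have B1 := frame_B F; have B0 : 0 < B by apply: lt_le_trans B1.
have l1 := frame_l F; have l0 : 0 < `|l| by apply: lt_trans l1.
have c0 : 0 < c by rewrite subr_gt0 invf_lt1.
have Lam1 : 1 <= Lam by apply: le_trans OmL.
have Lam0 : 0 < Lam by apply: lt_le_trans Lam1.
have Om0 : 0 < Om by apply: lt_le_trans Om1.
pose J := (Num.truncn Om).+1.
have OmJ : Om <= J%:R by have /andP[_ /ltW] := truncn_itv (ltW Om0).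
have JOm : J.+1%:R <= 3 * Om.
  by rewrite -natr1; have := truncnS_le (ltW Om0); rewrite -/J; lra.
have J0 : 0 < J%:R :> R by rewrite ltr0Sn.
(* The integer vectors [k] that occur lie in this box: [(Lam + 1) * B + B <= X] and [2 * B + B = Y].
   There are at most [73 * B^2 * Lam] of them, each with [J.+1 <= 3 * Om] pieces, whence 219. *)
pose X := 3 * B * Lam; pose Y := 3 * B.
have Y0 : 0 < Y by rewrite mulr_gt0.
have XY0 : 0 <= 8 * X * Y by rewrite /X /Y; nonneg.
pose K := (Num.truncn (8 * X * Y)).+1.
have KB : K%:R <= 73 * B ^+ 2 * Lam.
  apply: (le_trans (truncnS_le XY0)).
  have -> : 8 * X * Y = 72 * (B ^+ 2 * Lam) by rewrite /X /Y; ring.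
  have : 1 <= B ^+ 2 * Lam by rewrite -[leLHS]mulr1 ler_pM// exprn_ege1.
  lra.
pose V (u k : 'cV[R]_2) := iter n (mulmx (map_mx intr A)) u - u - k.
(* The right end of the interval of [eta] has index [J], hence [J.+1] pieces. *)
pose sub (v : 'cV[R]_2) := Num.truncn ((eta v + B * r) * (J%:R / (2 * B * r))).
have Br0 : 0 < 2 * B * r by rewrite !mulr_gt0.
have sub_pos v : `|v| <= r -> 0 <= (eta v + B * r) * (J%:R / (2 * B * r)).
  move=> vr; have := frame_eta_le F v.
  have : B * `|v| <= B * r by rewrite ler_wpM2l// ltW.
  move=> h1 h2; have := le_trans h2 h1; rewrite ler_norml => /andP[h _].
  by apply: mulr_ge0; [lra|nonneg].
have sub_lt v : `|v| <= r -> (sub v < J.+1)%N.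
  move=> vr; have := frame_eta_le F v.
  have : B * `|v| <= B * r by rewrite ler_wpM2l// ltW.
  move=> h1 h2; have := le_trans h2 h1; rewrite ler_norml => /andP[_ h].
  rewrite ltnS -(ler_nat R) (le_trans (y := (eta v + B * r) * (J%:R / (2 * B * r))))//.
    by rewrite truncn_le; exact: sub_pos.
  rewrite mulrA ler_pdivrMr// mulrC ler_wpM2l//; lra.
have small (u k : 'cV[R]_2) : `|u| <= 1 -> `|V u k| <= r -> `|xi k - 0| <= X /\ `|eta k - 0| <= Y.
  move=> u1 vr; have [xv ev] := frame_iterB n u k.
  have xu : `|xi u| <= B by apply: (le_trans (frame_xi_le F u)); rewrite ler_piMr// ltW.
  have eu : `|eta u| <= B by apply: (le_trans (frame_eta_le F u)); rewrite ler_piMr// ltW.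
  have v1 : `|V u k| <= 1 by apply: le_trans r1.
  have xV : `|xi (V u k)| <= B by apply: (le_trans (frame_xi_le F _)); rewrite ler_piMr// ltW.
  have eV : `|eta (V u k)| <= B by apply: (le_trans (frame_eta_le F _)); rewrite ler_piMr// ltW.
  have ln : `|l ^+ n - 1| <= Lam + 1.
    by apply: (le_trans (ler_normB _ _)); rewrite normr1 normrX.
  have mn : `|mu ^+ n - 1| <= 2.
    apply: (le_trans (ler_normB _ _)); rewrite normr1 normrX frame_mu.
    by have : `|l|^-1 ^+ n <= 1; [rewrite exprn_ile1 ?invr_ge0// invf_le1// ltW|lra].
  rewrite !subr0; split.
    have -> : xi k = (l ^+ n - 1) * xi u - xi (V u k) by rewrite xv; ring.
    apply: (le_trans (ler_normB _ _)); rewrite normrM.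
    have : `|l ^+ n - 1| * `|xi u| <= (Lam + 1) * B by apply: ler_pM.
    by rewrite /X; nra.
  have -> : eta k = (mu ^+ n - 1) * eta u - eta (V u k) by rewrite ev; ring.
  apply: (le_trans (ler_normB _ _)); rewrite normrM.
  have : `|mu ^+ n - 1| * `|eta u| <= 2 * B by apply: ler_pM.
  by rewrite /Y; lra.
(* The index [j] encodes the cell of [k] and the piece, as quotient and remainder by [J.+1]. *)
exists (K * J.+1)%N, (fun j => [set x | exists u k, [/\ x = \pi_T2 u, `|u| <= 1,
  k \is a mxOver Num.int, `|V u k| <= r &
  cell (xi := xi) 0 X Y k = (j %/ J.+1)%N /\ sub (V u k) = (j %% J.+1)%N]]).
split.
- rewrite natrM; apply: (@le_trans _ _ ((73 * B ^+ 2 * Lam) * (3 * Om))).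
    by apply: ler_pM.
  by rewrite le_eqVlt; apply/orP; left; apply/eqP; ring.
- move=> j _ _ [u [k [-> u1 ki vr [ck sk]]]] [u' [k' [-> u'1 k'i v'r [ck' sk']]]].
  have [xk yk] := small u k u1 vr; have [xk' yk'] := small u' k' u'1 v'r.
  have kk' : k = k' by apply: (cell_inj F Y0 ki k'i xk yk xk' yk'); rewrite ck ck'.
  rewrite -{}kk' in v'r sk' xk' yk' *.
  apply: (le_trans (torus_dist_le _ _)).
  have [xv ev] := frame_iterB n u k; have [xv' ev'] := frame_iterB n u' k.
  have dx : c * Lam * `|xi (u - u')| <= 2 * (B * r).
    apply: (@le_trans _ _ (`|l ^+ n - 1| * `|xi (u - u')|)).
      by rewrite ler_wpM2r//; exact: frame_expand.
    rewrite -normrM (_ : (l ^+ n - 1) * xi (u - u') = xi (V u k) - xi (V u' k)); last first.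
      by rewrite xv xv' (frame_xiB F); ring.
    apply: (le_trans (ler_normB _ _)).
    have h1 := frame_xi_le F (V u k); have h2 := frame_xi_le F (V u' k).
    have h3 : B * `|V u k| <= B * r by rewrite ler_wpM2l// ltW.
    have h4 : B * `|V u' k| <= B * r by rewrite ler_wpM2l// ltW.
    lra.
  have dy : c * J%:R * `|eta (u - u')| <= 2 * (B * r).
    have : `|eta (V u k) - eta (V u' k)| * (J%:R / (2 * B * r)) <= 1.
      have := truncn_eq_dist (sub_pos _ vr) (sub_pos _ v'r) (etrans sk (esym sk')).
      rewrite -mulrBl (_ : eta (V u k) + _ - _ = eta (V u k) - eta (V u' k)); last by ring.
      rewrite normrM [X in _ * X < 1 -> _]ger0_norm; first by move/ltW.
      by nonneg.
    rewrite [X in X <= 1 -> _]mulrA ler_pdivrMr// mul1r => h.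
    apply: (@le_trans _ _ (`|eta (V u k) - eta (V u' k)| * J%:R)); last by lra.
    rewrite mulrAC ler_wpM2r//.
    rewrite (_ : eta (V u k) - eta (V u' k) = (mu ^+ n - 1) * eta (u - u')); last first.
      by rewrite ev ev' (frame_etaB F); ring.
    by rewrite normrM ler_wpM2r//; exact: frame_contract.
  have Br1 : 0 <= B * r by nonneg.
  have dx' : `|xi (u - u')| <= 2 * (B * r) / (c * Om).
    rewrite ler_pdivlMr ?mulr_gt0// mulrC; apply: le_trans dx.
    by rewrite ler_wpM2r// ler_wpM2l// ltW.
  have dy' : `|eta (u - u')| <= 2 * (B * r) / (c * Om).
    rewrite ler_pdivlMr ?mulr_gt0// mulrC; apply: le_trans dy.
    by rewrite ler_wpM2r// ler_wpM2l// ltW.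
  apply: (le_trans (frame_edist_le F dx' dy')).
  rewrite le_eqVlt; apply/orP; left; apply/eqP.
  by field; rewrite !gt_eqF.
move=> u u1 [k ki kr].
have vr : `|V u k| <= r.
  by apply: ltW; apply: le_lt_trans kr; exact: norm_le_edist.
have [xk yk] := small u k u1 vr.
have c1 : (cell (xi := xi) 0 X Y k < K)%N by apply: cell_lt.
have c2 := sub_lt _ vr.
exists (cell (xi := xi) 0 X Y k * J.+1 + sub (V u k))%N.
  by apply: (@leq_trans ((cell (xi := xi) 0 X Y k).+1 * J.+1)%N);
    [rewrite mulSn addnC ltn_add2r|rewrite leq_pmul2r].
exists u, k; split => //.
by rewrite divnMDl// modnMDl divn_small// modn_small// addn0.
Qed.

(** [om] interpolates between one set per ellipse, [om = 0], and pieces as short as the ellipse is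
    thin, [om = L]. About [exp((L + om) n)] sets of diameter about [exp(-(alpha + om) n)] are used,
    so the last hypothesis is convergence of the series. *)
Lemma recurrent_measure0 (alpha L om s : R) : 0 < alpha -> 0 < L -> `|l| = expR L ->
  0 <= om <= L -> 0 < s -> L + om < (alpha + om) * s ->
  hausdorff_measure torus_dist s
    (recurrent_set (torus_map A) (fun n => expR (- (alpha * n%:R))) : set T2) = 0%E.
Proof.
move=> alpha0 L0 lL /andP[om0 omL] s0 hs.
have l1 := frame_l F; have l0 : 0 < `|l| by apply: lt_trans l1.
have B0 : 0 < B by apply: lt_le_trans (frame_B F).
pose r n : R := expR (- (alpha * n%:R)).
pose Om n : R := expR (om * n%:R).
pose c : R := 8 * B ^+ 2 / (1 - `|l|^-1).
have c0 : 0 <= c.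
  by rewrite /c; apply: divr_ge0; [nonneg|rewrite subr_ge0 invf_le1// ltW].
have lamE n : `|l| ^+ n = expR (L * n%:R) by rewrite lL -expRM_natl mulrC.
have /choice[NW NWP] : forall n, exists NW : nat * (nat -> set T2), (0 < n)%N ->
  [/\ NW.1%:R <= 219 * B ^+ 2 * (`|l| ^+ n * Om n),
    forall j x y, NW.2 j x -> NW.2 j y -> torus_dist x y <= c * (r n / Om n) &
    forall u, `|u| <= 1 -> return_set A r n u -> exists2 j, (j < NW.1)%N & NW.2 j (\pi_T2 u)].
  case=> [|n]; first by exists (0%N, fun=> set0).
  have [||||| N [W h]] := @return_cover n.+1 (r n.+1) (Om n.+1).
  - by [].
  - exact: expR_gt0.
  - by rewrite -expR0 ler_expR oppr_le0 mulr_ge0// ltW.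
  - by rewrite -expR0 ler_expR mulr_ge0.
  - by rewrite lamE ler_expR ler_wpM2r.
  by exists (N, W).
pose N n := if (0 < n)%N then (NW n).1 else 0%N.
pose W n j := if (0 < n)%N then (NW n).2 j else set0.
pose q1 := expR (- (alpha + om)).
pose q2 := expR (L + om - (alpha + om) * s).
have q11 : 0 <= q1 < 1.
  by rewrite expR_ge0 expR_lt1 oppr_lt0 ltr_wpDr.
have q21 : 0 <= q2 < 1 by rewrite expR_ge0 expR_lt1 subr_lt0.
have rO n : r n / Om n = q1 ^+ n.
  by rewrite /r /Om -expRN -expRD /q1 -expRM_natl; congr expR; ring.
have C0 : 0 <= 219 * B ^+ 2 * c `^ s.
  exact: (mulr_ge0 (mulr_ge0 (ler0n R 219) (sqr_ge0 B)) (powR_ge0 c s)).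
apply: (@hausdorff_measure_limsup0 _ _ _ _ s N (fun n => c * (r n / Om n)) W
   c q1 (219 * B ^+ 2 * c `^ s) q2 s0) => //.
- exact: torus_dist_ge0.
- by move=> n; rewrite rO lexx andbT mulr_ge0// exprn_ge0//; case/andP: q11.
- move=> n; rewrite powRM// ?rO ?exprn_ge0 ?expR_ge0//.
  rewrite /N; case: ifP => n0; last first.
    rewrite mul0r; apply: mulr_ge0 C0 _.
    by apply: exprn_ge0; case/andP: q21.
  have [h _ _] := NWP n n0.
  apply: (@le_trans _ _ (219 * B ^+ 2 * (`|l| ^+ n * Om n) * (c `^ s * (q1 ^+ n) `^ s))).
    by rewrite ler_wpM2r// mulr_ge0 ?powR_ge0.
  have -> : (q1 ^+ n) `^ s = expR (- (alpha + om) * n%:R * s).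
    by rewrite /q1 -expRM_natl -expRM; congr expR; ring.
  have -> : q2 ^+ n = expR (L * n%:R) * expR (om * n%:R) * expR (- (alpha + om) * n%:R * s).
    by rewrite /q2 -expRM_natl -!expRD; congr expR; ring.
  rewrite lamE /Om le_eqVlt; apply/orP; left; apply/eqP; ring.
- move=> n j x y; rewrite /W; case: ifP => // n0.
  by have [_ + _] := NWP n n0; apply.
move=> x n0 xE; have [u xu u1] := torus_repr_unit x.
move: xE; rewrite xu => /recurrent_liftP/(_ n0)[n n0n [n1 hn]].
exists n => //; have [_ _ /(_ u u1 hn)[j jN Wj]] := NWP n n1.
by exists j; rewrite /N /W n1.
Qed.

(** The critical exponent [(L + om) / (alpha + om)] is monotone in [om], so the two ends of the
    range of [om] are the best choices and give the two terms of the minimum. *)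
Lemma recurrent_dim_le (alpha L : R) : 0 < alpha -> 0 < L -> `|l| = expR L ->
  (hausdorff_dim torus_dist
    (recurrent_set (torus_map A) (fun n => expR (- (alpha * n%:R))) : set T2) <=
   (Num.min (2 * L / (alpha + L)) (L / alpha))%:E)%E.
Proof.
move=> alpha0 L0 lL; apply/lee_addgt0Pr => e e0; rewrite -EFinD.
apply: ereal_inf_lbound.
set s0 := Num.min _ _.
have s0_gt0 : 0 < s0 by rewrite lt_min !divr_gt0// ?mulr_gt0// addr_gt0.
exists (s0 + e) => //; split; first by rewrite addr_ge0// ltW.
have [h|h] : s0 = 2 * L / (alpha + L) \/ s0 = L / alpha.
- by rewrite /s0 minEle; case: ifP; [left|right].
- apply: (recurrent_measure0 (alpha := alpha) (L := L) (om := L)) => //; rewrite ?lexx ?(ltW L0) ?addr_gt0//.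
  rewrite mulrDr h mulrCA mulfV ?gt_eqF ?addr_gt0// mulr1.
  by have : 0 < (alpha + L) * e; [rewrite mulr_gt0// addr_gt0|lra].
apply: (recurrent_measure0 (alpha := alpha) (L := L) (om := 0)) => //; rewrite ?lexx ?(ltW L0) ?addr_gt0//.
by rewrite !addr0 mulrDr h mulrCA mulfV ?gt_eqF// mulr1 ltrDl mulr_gt0.
Qed.

End UpperBound.

Theorem theorem1p4 (R : realType) (A : 'M[int]_2) (lambda : R[i]) (alpha : R)
    (A_det : `|\det A| = 1)
    (lambda_eig : eigenvalue (map_mx intr A : 'M[R[i]]_2) lambda)
    (lambda_gt1 : 1 < `|lambda|)
    (alpha_gt0 : 0 < alpha) :
  let r := fun n : nat => expR (- (alpha * n%:R)) in
  let E := recurrent_set (torus_map A) r in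
  let L := ln (complex.Re `|lambda|) in
  let s0 := Num.min (2 * L / (alpha + L)) (L / alpha) in
  hausdorff_dim torus_dist E = s0%:E /\ torus_large_intersection s0 E.
Proof.
move=> r E L s0.
have [l [labs l1 lroot]] := real_eigenvalue A_det lambda_eig lambda_gt1.
have [mu [xi [eta [mk [B F]]]]] := hyperbolic_frame_exists A_det l1 lroot.
have lL : `|l| = expR L by rewrite /L -labs lnK// posrE (lt_trans ltr01 l1).
have L0 : 0 < L by rewrite /L -labs ln_gt0.
have ubi s : 0 < s < s0 -> ubiquitous s (return_set A r).
  move=> /andP[sgt0]; rewrite lt_min => /andP[s1 s2].
  exact: (return_ubiquitous F alpha_gt0 L0 lL).
have s02 : s0 <= 2.
  rewrite ge_min; apply/orP; left.
  by rewrite ler_pdivrMr ?addr_gt0// ler_wpM2l// lerDr ltW.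
split; last exact: recurrent_large_intersection.
apply/le_anti/andP; split; first exact: (recurrent_dim_le F).
exact: recurrent_dim_ge.
Qed.
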